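(* Let $n,q$ be positive integers such that $q=p^k$ is a power of a prime $p\ge 2$ (with $k\ge 1$), and let $d=n(q-1)$. Let $\Delta=\mathrm{conv}\{a_0,\ldots,a_d\}\subset\mathbb{R}^d$ be a non-degenerate simplex with barycenter at the origin, and for $0\le i\le d$ let $F_i$ be the facet of $\Delta$ opposite to the vertex $a_i$. Let $\mu_1,\mu_2,\ldots,\mu_n$ be continuous measures on $\mathbb{R}^d$ with bounded support. Then there exist a point $x\in\mathbb{R}^d$, giving a translate $x+\mathcal{F}_\Delta=\{x+\mathrm{cone}(F_i)\}_{i=0}^d$ of the face fan of $\Delta$, and an allocation function $\theta:\{0,1,\ldots,d\}\to\{1,\ldots,q\}$ such that for each $i=1,\ldots,n$ and all $j=1,2,\ldots,q$, $$\sum_{\nu:\ \theta(\nu)=j}\mu_i\bigl(x+\mathrm{cone}(F_\nu)\bigr)=\frac1q\,\mu_i(\mathbb{R}^d).$$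
   Context: A continuous measure on $\mathbb{R}^d$ is a finite Borel measure for which every affine hyperplane has measure zero. For $F\subset\mathbb{R}^d$, $\mathrm{cone}(F)=\{ty: t\ge 0,\ y\in F\}$. *)

(* Defs.v *)
From HB Require Import structures.
From mathcomp Require Import all_boot all_order all_algebra.
From mathcomp Require Import all_classical all_reals all_analysis.

Set Implicit Arguments.
Unset Strict Implicit.
Unset Printing Implicit Defensive.

Import Order.TTheory GRing.Theory Num.Theory.
Import numFieldNormedType.Exports.

Local Open Scope classical_set_scope.
Local Open Scope ring_scope.

(* R^d as row vectors with the Borel sigma-algebra.  The topology on 'rV[R]_d
   is that of the max norm, so its open and bounded sets are the usual ones. *)
Notation borelRd R d := (g_sigma_algebraType (@open 'rV[R]_d)).

Section ConvexGeometry.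
Context {R : realType} {V : lmodType R}.

Definition convex_hull (A : set V) : set V := smallest (@convex_set R V) A.

Definition cone (F : set V) : set V :=
  [set t *: y | t in [set t : R | 0 <= t] & y in F].

Definition translate (x : V) (A : set V) : set V := [set x + y | y in A].

Definition affinely_independent (I : finType) (a : I -> V) : Prop :=
  forall c : I -> R, \sum_i c i = 0 -> \sum_i c i *: a i = 0 ->
    forall i, c i = 0.

Definition barycenter (I : finType) (a : I -> V) : V :=
  #|I|%:R^-1 *: \sum_i a i.

(* The facet, opposite to a i, of the simplex with vertex family a. *)
Definition facet (I : finType) (a : I -> V) (i : I) : set V :=
  convex_hull (a @` [set j | j != i]).

End ConvexGeometry.

Section Measures.
Context {R : realType} {d : nat}.

Definition hyperplane (u : 'rV[R]_d) (c : R) : set 'rV[R]_d :=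
  [set x | \sum_(i < d) u ord0 i * x ord0 i = c].

(* Finiteness is carried by the type of mu. *)
Definition continuous_measure
    (mu : {finite_measure set (borelRd R d) -> \bar R}) : Prop :=
  forall (u : 'rV[R]_d) (c : R), u != 0 -> mu (hyperplane u c) = 0%E.

Definition measure_support
    (mu : {finite_measure set (borelRd R d) -> \bar R}) : set 'rV[R]_d :=
  [set x | forall U : set 'rV[R]_d, open U -> U x -> (0 < mu U)%E].

End Measures.

(* Main.v *)
Require Import Defs.
From HB Require Import structures.
From mathcomp Require Import all_boot all_order all_algebra all_fingroup all_field.
From mathcomp Require Import all_classical all_reals all_analysis.
From mathcomp Require Import zify ring lra.
Set Implicit Arguments.
Unset Strict Implicit.
Unset Printing Implicit Defensive.
Import Order.TTheory GRing.Theory Num.Theory.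
Import numFieldNormedType.Exports.
Local Open Scope ring_scope.

(** The idea of the proof.

Geometry.  Every vector y is sum_j beta_j(y) a_j for unique linear forms
beta_j with sum_j beta_j = 0, and cone(F_nu) is the set where beta_nu is the
smallest of them ([translated_coneE]).  The cells of a translated fan therefore
cover the space and overlap inside hyperplanes, so that the measures of the
cells add up to the total mass ([fan_measure_sum]).  A point v of the cube
[0,1]^d is sent to a point t of the standard simplex, and the fan is moved to
the apex rad * sum_nu t_nu a_nu.  If t_nu = 0 and rad is large, the nu-th cell
misses the supports ([exists_radius]).  The measure of a cell is an upper
semicontinuous function of v ([fan_cell_usc]).  What remains is a statement on
functions G_(i,nu) on the cube with these three properties: some point v and
some theta : {0..d} -> [q] give sum_(theta nu = j) G_(i,nu)(v) = S_i / q for all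
i and j ([exists_equipartition]).

From q parts to p parts.  Identify [q] with a field F of q = p^k elements and
let T be its trace to the prime field.  A real function on F is constant as
soon as, for each nonzero alpha, its sums over the p level sets of
x |-> T (alpha x) agree ([constant_of_projections]).  Multiplying alpha by a
nonzero element of the prime field permutes these level sets, so (q-1)/(p-1)
scalars alpha suffice.  There are B = n (q-1)/(p-1) conditions b = (i, alpha),
and d = B (p-1).

Combinatorics.  Triangulate a fine grid on the cube and give each vertex v, for
each b and each theta in F^(d+1), the value T (alpha x) at which the share of
measure i is largest.  If each b sees all p labels on one simplex, then all p
shares are almost S_i / p, and a limit over finer grids concludes.  Such a
simplex is detected by a cocycle.  The Vandermonde product of p labels is a
(p-1)-cocycle that vanishes unless the labels are distinct, and the cup product
Z of B of them is a d-cocycle ([cocycle_cup_vandermonde]).  Assume that Z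
vanishes on all simplices, sum it over the oriented simplices and then over all
theta with theta_0 = 0, with the weight
   w = prod_m (theta_(m+1) - theta_m)^(r-1) * (prod_b V_(p-1))^r,   r = q / p,
where V_(p-1) is the Vandermonde product of the first p-1 entries of a block.
The weight is invariant under translations and has degree at most q - 2 in each
theta_nu, hence its sum along each coordinate line is zero ([weight_line]).
Since labels on a facet of the cube do not see one of the theta_nu, this kills
all boundary terms and the total does not depend on the labels
([weighted_label_sum_invariant]).  For the labels T (alpha theta_lambda), with
lambda the first zero coordinate of the vertex, one simplex contributes and the
total is a product over the blocks ([weighted_sum_cup_neq0]).  By a comparison of
power sums a block has the same value as its analogue over the prime field
([step_sum_moment]), where all nonzero terms coincide and their number is
(p-1)!, which is prime to p ([prime_walk_sum]).  So the total is not zero, which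
contradicts the assumption. *)

(** * Sums over words *)

Section ListSums.
Context {A : finType} {R : comNzRingType}.

(** A sum over all words of a given length is kept as an iterated sum, so that
    summing along one letter, or over one block of letters, is an induction. *)
Fixpoint list_sum (N : nat) (Psi : seq A -> R) : R :=
  if N is N'.+1 then \sum_(y : A) list_sum N' (fun s => Psi (y :: s))
  else Psi [::].

Lemma eq_list_sum N Psi Psi' :
  (forall s, size s = N -> Psi s = Psi' s) -> list_sum N Psi = list_sum N Psi'.
Proof.
elim: N Psi Psi' => [|N IH] Psi Psi' E /=; first by rewrite E.
by apply: eq_bigr => y _; apply: IH => s ss; apply: E; rewrite /= ss.
Qed.

Lemma list_sum_bigsum N (I : Type) (r : seq I) (P : pred I) (Psi : I -> seq A -> R) :
  list_sum N (fun s => \sum_(i <- r | P i) Psi i s)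
    = \sum_(i <- r | P i) list_sum N (Psi i).
Proof.
elim: N Psi => [//|N IH] Psi /=.
rewrite exchange_big /=; apply: eq_bigr => y _.
exact: (IH (fun i s => Psi i (y :: s))).
Qed.

Lemma list_sumZ N c (Psi : seq A -> R) :
  list_sum N (fun s => c * Psi s) = c * list_sum N Psi.
Proof.
elim: N Psi => [//|N IH] Psi /=.
by rewrite big_distrr /=; apply: eq_bigr => y _; exact: IH.
Qed.

Lemma list_sumB N (Psi Psi' : seq A -> R) :
  list_sum N (fun s => Psi s - Psi' s) = list_sum N Psi - list_sum N Psi'.
Proof.
elim: N Psi Psi' => [//|N IH] Psi Psi' /=.
by rewrite -sumrB; apply: eq_bigr => y _; exact: IH.
Qed.

Lemma list_sum0 N : list_sum N (fun=> 0) = 0 :> R.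
Proof. by elim: N => [//|N IH] /=; rewrite big1. Qed.

Lemma list_sum_cat N M (Psi : seq A -> R) :
  list_sum (N + M)%N Psi
    = list_sum N (fun s => list_sum M (fun t => Psi (s ++ t))).
Proof. by elim: N Psi => [//|N IH] Psi /=; apply: eq_bigr => y _; exact: IH. Qed.

Lemma list_sum_prod N x0 (f : nat -> A -> R) :
  list_sum N (fun s => \prod_(m < N) f m (nth x0 s m))
    = \prod_(m < N) \sum_y f m y.
Proof.
elim: N f => [|N IH] f /=; first by rewrite !big_ord0.
rewrite big_ord_recl /= big_distrl /=; apply: eq_bigr => y _.
under eq_list_sum => s _ do rewrite big_ord_recl /=.
by rewrite list_sumZ (IH (fun m => f m.+1)).
Qed.

(** The remaining letters can be fixed first, because the order of summation is
    immaterial. *)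
Lemma list_sum_line N x0 nu (Psi : seq A -> R) : (nu < N)%N ->
  (forall s, size s = N -> \sum_a Psi (set_nth x0 s nu a) = 0) ->
  list_sum N Psi = 0.
Proof.
elim: N nu Psi => [//|N IH] [|nu] Psi lt_nu H /=.
  rewrite -list_sum_bigsum -[RHS](list_sum0 N); apply: eq_list_sum => s ss.
  by rewrite -[RHS](H (x0 :: s)) /= ?ss.
apply: big1 => y _; apply: (IH nu) => // s ss.
by rewrite -[RHS](H (y :: s)) /= ?ss.
Qed.

End ListSums.

Lemma list_sum_bij (A B : finType) (R : comNzRingType) N (h : A -> B)
    (Psi : seq B -> R) :
  bijective h -> list_sum N (fun s => Psi (map h s)) = list_sum N Psi.
Proof.
move=> bh; elim: N Psi => [//|N IH] Psi /=.
rewrite (reindex h) /=; last exact: onW_bij.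
by apply: eq_bigr => y _; exact: (IH (fun s => Psi (h y :: s))).
Qed.

(** For each starting point c, a word of positions and the word of its successive
    steps determine each other. *)
Lemma list_sum_steps (A : finZmodType) (R : comNzRingType) N (c : A)
    (Psi : seq A -> R) :
  list_sum N Psi = list_sum N (fun s => Psi (scanl +%R c s)).
Proof.
elim: N c Psi => [//|N IH] c Psi /=.
rewrite (reindex (fun y => c + y)) /=; last first.
  by apply: onW_bij; exists (fun y => y - c) => y; rewrite addrC ?addKr ?subrK.
by apply: eq_bigr => y _; rewrite (IH (c + y)).
Qed.

(** * The Vandermonde cocycle, cup products and the prism homotopy *)

Section Cochains.
Context {R : comNzRingType}.

Definition vandermonde m (x : nat -> R) : R := \prod_(j < m) \prod_(i < j) (x j - x i).

Lemma eq_vandermonde m x x' : (forall i, (i < m)%N -> x i = x' i) -> vandermonde m x = vandermonde m x'.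
Proof.
move=> E; apply: eq_bigr => j _; apply: eq_bigr => i _.
by rewrite !E // (ltn_trans (ltn_ord i)).
Qed.

Lemma vandermonde_det m x : vandermonde m x = \det (\matrix_(i < m, j < m) x i ^+ j).
Proof.
have -> : (\matrix_(i < m, j < m) x i ^+ j) = (Vandermonde m (\row_(j < m) x j))^T.
  by apply/matrixP => i j; rewrite !mxE.
rewrite det_tr det_Vandermonde (exchange_big_dep predT) //=.
apply: eq_bigr => j _; rewrite (big_ord_widen m (fun i => x j - x i)) ?(ltnW (ltn_ord j)) //.
by apply: eq_bigr => i _; rewrite !mxE.
Qed.

Lemma vandermondeS m x : vandermonde m.+1 x = vandermonde m x * \prod_(i < m) (x m - x i).
Proof. by rewrite /vandermonde big_ord_recr. Qed.

(** The sum is the Laplace expansion of a determinant whose first two columns are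
    both constant equal to 1. *)
Lemma vandermonde_cocycle m x :
  \sum_(k < m.+2) (-1) ^+ k * vandermonde m.+1 (fun i => x (bump k i)) = 0.
Proof.
pose M := \matrix_(i < m.+2, j < m.+2) x i ^+ j.-1.
have detM : \det M = 0.
  rewrite -det_tr; apply: (@determinant_alternate _ _ _ ord0 (lift ord0 ord0)) => // j.
  by rewrite !mxE.
rewrite -[RHS]detM (expand_det_col M ord0); apply: eq_bigr => k _.
rewrite mxE expr0 mul1r /cofactor addn0 vandermonde_det; congr (_ * \det _).
by apply/matrixP => i j; rewrite !mxE.
Qed.

Lemma vandermonde_repeat m x i j : (i < j < m)%N -> x i = x j -> vandermonde m x = 0.
Proof.
case/andP=> ij jm E; rewrite /vandermonde (bigD1 (Ordinal jm)) //= (bigD1 (Ordinal ij)) //=.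
by rewrite E subrr !mul0r.
Qed.

Lemma vandermonde_shift m x c : vandermonde m (fun i => x i + c) = vandermonde m x.
Proof.
by apply: eq_bigr => j _; apply: eq_bigr => i _; rewrite opprD addrACA subrr addr0.
Qed.

Context {L : Type}.
Implicit Types (x a b : nat -> L) (f g Z : (nat -> L) -> R).

(** A d-cochain: it only reads the entries of index 0 to d. *)
Definition local d f := forall x x', (forall i, (i <= d)%N -> x i = x' i) -> f x = f x'.

Definition coboundary d f x := \sum_(k < d.+1) (-1) ^+ k * f (fun i => x (bump k i)).

Definition cocycle d f := forall x, coboundary d.+1 f x = 0.

Definition cup d f g x := f x * g (fun i => x (d + i)%N).

Lemma local_cup d e f g : local d f -> local e g -> local (d + e)%N (cup d f g).
Proof.
move=> lf lg x x' E; congr (_ * _).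
  by apply: lf => i le_i; apply: E; rewrite (leq_trans le_i) ?leq_addr.
by apply: lg => i le_i; apply: E; rewrite leq_add2l.
Qed.

(** Faces of index at most d act on the first factor and the others on the second.
    Once the cocycle relations are used, the two sums leave the same product, with
    opposite signs, in which the common vertex has been dropped from one factor. *)
Lemma cocycle_cup d e f g : local d f -> local e g ->
  cocycle d f -> cocycle e g -> cocycle (d + e)%N (cup d f g).
Proof.
move=> lf lg cf cg x; rewrite /coboundary.
have -> : ((d + e).+2 = d.+1 + e.+1)%N by rewrite addSn addnS.
rewrite big_split_ord /=.
have -> : \sum_(i < d.+1) (-1) ^+ i * cup d f g (fun j => x (bump i j))
   = (-1) ^+ d * (f x * g (fun j => x (d.+1 + j)%N)).
  under eq_bigr => i _.
    rewrite /cup (_ : g _ = g (fun j => x (d.+1 + j)%N)) ?mulrA; last first.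
      apply: lg => j _; congr x; rewrite /bump; have := ltn_ord i; lia.
    over.
  rewrite -big_distrl /= mulrA; congr (_ * _).
  have := cf x; rewrite /coboundary big_ord_recr /= => /eqP.
  rewrite addr_eq0 => /eqP ->; rewrite exprS mulN1r mulNr opprK; congr (_ * _).
  apply: lf => i le_i; congr x; rewrite /bump; lia.
have -> : \sum_(i < e.+1) (-1) ^+ (d.+1 + i)%N * cup d f g (fun j => x (bump (d.+1 + i)%N j))
   = - ((-1) ^+ d * (f x * g (fun j => x (d.+1 + j)%N))).
  under eq_bigr => i _.
    rewrite /cup (_ : f _ = f x); last first.
      by apply: lf => j le_j; congr x; rewrite /bump; lia.
    rewrite (_ : g _ = g (fun j => x (d + bump i.+1 j)%N)); last first.
      by apply: lg => j _; congr x; rewrite /bump; lia.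
    rewrite (_ : _ * (_ * _) = (-1) ^+ d * f x * ((-1) ^+ i.+1 * g (fun j => x (d + bump i.+1 j)%N))); last first.
      by rewrite addSnnS exprD; ring.
    over.
  rewrite -big_distrr /= -mulrN -mulrA -mulrN; congr (_ * (_ * _)).
  have := cg (fun j => x (d + j)%N); rewrite /coboundary big_ord_recl /= expr0 mul1r => /eqP.
  rewrite addrC addr_eq0 => /eqP -> //; congr (- _).
  by apply: lg => j _; congr x; rewrite /bump; lia.
by rewrite subrr.
Qed.

(** The i-th simplex of the triangulated prism between the simplices a and b. *)
Definition prism_path a b i : nat -> L := fun k => if (k <= i)%N then a k else b k.-1.

Definition prism d Z a b := \sum_(i < d) (-1) ^+ i * Z (prism_path a b i).

(** Add up the cocycle relations on the simplices of the prism.  The two faces of a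
    prism simplex at its vertical edge telescope, and all other faces are prism
    simplices over a face of a and b. *)
Lemma prism_homotopy d Z a b : local d Z -> cocycle d Z ->
  Z b - Z a = \sum_(k < d.+1) (-1) ^+ k *
     prism d Z (fun i => a (bump k i)) (fun i => b (bump k i)).
Proof.
move=> lZ cZ.
pose mid i : nat -> L := fun k => if (k < i)%N then a k else b k.
pose G i k : R := (-1) ^+ (i + k)%N * Z (fun j => prism_path a b i (bump k j)).
have E0 : \sum_(i < d.+1) \sum_(k < d.+2) G i k = 0.
  apply: big1 => i _; under eq_bigr => k _ do rewrite /G exprD -mulrA.
  by rewrite -big_distrr /= -[X in _ * X]/(coboundary d.+1 Z (prism_path a b i)) cZ mulr0.
have Gd i : (i < d.+1)%N -> G i i = Z (mid i).
  move=> lt_i; rewrite /G addnn -mul2n exprM sqrrN expr1n expr1n mul1r.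
  apply: lZ => k _; rewrite /prism_path /mid /bump.
  by case: (ltnP k i) => ki; rewrite ?add0n ?add1n ?(ltnW ki) ?ltnNge ?ki //= leqNgt ltnS.
have Gs i : (i < d.+1)%N -> G i i.+1 = - Z (mid i.+1).
  move=> lt_i; rewrite /G addnS addnn -mul2n exprS exprM sqrrN expr1n expr1n mulr1 mulN1r.
  congr (- _); apply: lZ => k _; rewrite /prism_path /mid /bump ltnS.
  case: (leqP k i) => ki; first by rewrite add0n ki.
  by rewrite add1n ltnNge (ltnW ki).
have Glt i k : (k <= i)%N -> (i < d)%N ->
   G i.+1 k = - ((-1) ^+ k * ((-1) ^+ i * Z (prism_path (fun j => a (bump k j)) (fun j => b (bump k j)) i))).
  move=> ki lt_i; rewrite /G addSn exprS mulN1r mulNr exprD; congr (- _).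
  rewrite mulrCA mulrA; congr (_ * _); apply: lZ => j _; rewrite /prism_path /bump.
  case: (leqP j i) => ji.
    by rewrite (_ : (k <= j) + j <= i.+1)%N //; lia.
  rewrite (_ : ((k <= j) + j <= i.+1)%N = false); last by lia.
  by congr b; lia.
have Ggt i k : (i < k)%N -> (k <= d)%N ->
   G i k.+1 = - ((-1) ^+ k * ((-1) ^+ i * Z (prism_path (fun j => a (bump k j)) (fun j => b (bump k j)) i))).
  move=> ki lt_k; rewrite /G addnS exprS mulN1r mulNr exprD; congr (- _).
  rewrite mulrCA mulrA; congr (_ * _); apply: lZ => j _; rewrite /prism_path /bump.
  case: (leqP j i) => ji.
    by rewrite (_ : ((k < j) + j <= i)%N) ; [congr a; lia | lia].
  rewrite (_ : ((k < j) + j <= i)%N = false); last by lia.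
  by congr b; lia.
pose h i k := (-1) ^+ k * ((-1) ^+ i * Z (prism_path (fun j => a (bump k j)) (fun j => b (bump k j)) i)).
have Esplit : \sum_(i < d.+1) \sum_(k < d.+2) G i k
   = \sum_(i < d.+1) (G i i + G i i.+1)
     + \sum_(i < d.+1) (\sum_(k < d.+2 | (k < i)%N) G i k + \sum_(k < d.+2 | (i.+1 < k)%N) G i k).
  rewrite -big_split /=; apply: eq_bigr => i _.
  have hi : (i < d.+2)%N by rewrite ltnS ltnW.
  have hi1 : (i.+1 < d.+2)%N by rewrite ltnS.
  rewrite (bigD1 (Ordinal hi)) //= (bigD1 (Ordinal hi1)) /=; last by rewrite -val_eqE /=; lia.
  rewrite addrA; congr (_ + _); rewrite (bigID (fun k : 'I_d.+2 => (k < i)%N)) /=; congr (_ + _).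
    by apply: eq_bigl => k; rewrite -!val_eqE /=; lia.
  by apply: eq_bigl => k; rewrite -!val_eqE /=; lia.
have Ediag : \sum_(i < d.+1) (G i i + G i i.+1) = Z b - Z a.
  under eq_bigr => i _ do rewrite Gd // Gs //.
  rewrite -(big_mkord predT (fun i => Z (mid i) - Z (mid i.+1))).
  rewrite (telescope_sumr_eq (fun i => - Z (mid i))) //.
    rewrite opprK addrC; congr (_ - _); apply: lZ => k le_k; rewrite /mid //.
    by rewrite ltnS le_k.
  by move=> k _; rewrite opprK addrC.
have Eoff : \sum_(i < d.+1) (\sum_(k < d.+2 | (k < i)%N) G i k + \sum_(k < d.+2 | (i.+1 < k)%N) G i k)
   = - \sum_(k < d.+1) \sum_(i < d) h i k.
  rewrite big_split /=.
  have -> : \sum_(i < d.+1) \sum_(k < d.+2 | (k < i)%N) G i k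
     = \sum_(i < d) \sum_(k < d.+1) (if (k <= i)%N then - h i k else 0).
    rewrite big_ord_recl big1 ?add0r //.
    apply: eq_bigr => i _; rewrite big_mkcond big_ord_recr /= ifF ?addr0; last first.
      by rewrite /bump; have := ltn_ord i; lia.
    by apply: eq_bigr => k _; rewrite ltnS; case: ifP => // ki; rewrite -Glt.
  have -> : \sum_(i < d.+1) \sum_(k < d.+2 | (i.+1 < k)%N) G i k
     = \sum_(i < d) \sum_(k < d.+1) (if (k <= i)%N then 0 else - h i k).
    rewrite big_ord_recr /= [X in _ + X]big1 ?addr0; last first.
      by move=> k; have := ltn_ord k; lia.
    apply: eq_bigr => i _; rewrite big_mkcond big_ord_recl /= add0r.
    apply: eq_bigr => k _; rewrite /bump /= add1n ltnS ltnNge; case: leqP => //= ki.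
    by rewrite Ggt // -ltnS.
  rewrite -big_split /= [in RHS]exchange_big /= -sumrN; apply: eq_bigr => i _; rewrite -big_split -sumrN /=.
  by apply: eq_bigr => k _; case: ifP; rewrite ?addr0 ?add0r.
move: E0; rewrite Esplit Ediag Eoff => /eqP; rewrite subr_eq0 => /eqP ->.
by apply: eq_bigr => k _; rewrite /prism big_distrr.
Qed.

End Cochains.

(** * Stokes' formula on the Kuhn triangulation of a grid *)

(** Multiplication by a transposition exchanges even and odd permutations.  Pairing
    the two classes term by term also works in characteristic 2. *)
Lemma signed_perm_sum_swap (R : pzRingType) n (a b : 'I_n) (g : 'S_n -> R) :
  a != b -> (forall s, g (s * tperm a b)%g = g s) ->
  \sum_(s : 'S_n) (-1) ^+ s * g s = 0.
Proof.
move=> ab gt; rewrite (bigID (@odd_perm _)) /=.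
rewrite [X in _ + X](reindex (fun s => (s * tperm a b)%g)) /=; last first.
  by apply: onW_bij; exists (fun s => (s * tperm a b)%g) => s; rewrite -mulgA tperm2 mulg1.
rewrite [X in _ + X](eq_big (fun s : 'S_n => odd_perm s) (fun s => - ((-1) ^+ s * g s))).
- by rewrite sumrN subrr.
- by move=> s; rewrite odd_permM odd_tperm ab addbT negbK.
- by move=> s _; rewrite odd_permM odd_tperm ab addbT gt signrN mulNr.
Qed.

Section Kuhn.
Context {R : comNzRingType} (d' M : nat).
Local Notation d := d'.+1.

(** The j-th vertex of the Kuhn simplex that starts at u and increases the
    coordinates one at a time, the coordinate m being the (s m)-th to move. *)
Definition kuhn_vertex (u : {ffun 'I_d -> 'I_M}) (s : 'S_d) (j : nat) : 'I_d -> nat :=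
  fun m => (u m + (s m < j))%N.

(** The grid may be closed up to a cycle in the direction x, since K vanishes where
    the ends are glued. *)
Lemma sum_grid_shift (x : 'I_d) (K : ('I_d -> nat) -> R) :
  (forall v, v x = 0%N \/ v x = M -> K v = 0) ->
  \sum_(u : {ffun 'I_d -> 'I_M}) K (fun y => (u y + (y == x))%N)
    = \sum_(u : {ffun 'I_d -> 'I_M}) K (fun y => nat_of_ord (u y)).
Proof.
move=> K0; pose h (f : 'I_M -> 'I_M) (u : {ffun 'I_d -> 'I_M}) :=
  [ffun y => if y == x then f (u y) else u y].
rewrite [RHS](reindex (h (ordS (n := M)))) /=; last first.
  apply: onW_bij; exists (h (ord_pred (n := M))) => u; apply/ffunP => y;
    by rewrite !ffunE; case: (eqVneq y x) => // _; rewrite ?ordSK ?ord_predK.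
apply: eq_bigr => u _; have [ux|ux] := eqVneq (u x).+1 M.
  rewrite !K0 //; first by left; rewrite ffunE eqxx /= ux modnn.
  by right; rewrite eqxx addn1.
congr K; apply: funext => y; rewrite ffunE.
have [->|] := eqVneq y x; last by rewrite addn0.
by rewrite /= addn1 modn_small //; have := ltn_ord (u x); lia.
Qed.

(** An interior face belongs to two simplices, which differ by a transposition.  The
    face that drops the first vertex is the face dropping the last vertex of the
    simplex shifted by one in the first direction, whose order of directions is
    rotated. *)
Lemma kuhn_stokes (f : (nat -> 'I_d -> nat) -> R) :
  local d' f ->
  (forall v m c, c = 0%N \/ c = M -> (forall j, (j <= d')%N -> v j m = c) -> f v = 0) ->
  \sum_(u : {ffun 'I_d -> 'I_M}) \sum_(s : 'S_d)
     (-1) ^+ s * coboundary d f (kuhn_vertex u s) = 0.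
Proof.
move=> lf f0; rewrite /coboundary.
pose g k u s := f (fun i => kuhn_vertex u s (bump k i)).
transitivity (\sum_(k < d.+1) (-1) ^+ k *
   \sum_(u : {ffun 'I_d -> 'I_M}) \sum_(s : 'S_d) (-1) ^+ s * g k u s).
  under eq_bigr => u _ do under eq_bigr => s _ do rewrite big_distrr /=.
  under eq_bigr => u _ do rewrite exchange_big /=.
  rewrite exchange_big /=; apply: eq_bigr => k _; rewrite big_distrr /=.
  apply: eq_bigr => u _; rewrite big_distrr /=.
  by apply: eq_bigr => s _; rewrite mulrCA.
rewrite big_ord_recl big_ord_recr /= expr0 mul1r.
rewrite [X in _ + (X + _)]big1 ?add0r; last first.
  move=> k _; rewrite big1 ?mulr0 // => u _.
  apply: (@signed_perm_sum_swap _ _ (widen_ord (leqnSn _) k) (lift ord0 k)) => [|s].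
    by rewrite -val_eqE /= /bump; lia.
  congr f; apply: funext => j; apply: funext => m; rewrite /kuhn_vertex permM.
  congr (_ + nat_of_bool _)%N; case: tpermP => [->|->|] //; rewrite /= /bump; lia.
(* The rotation i |-> i - 1 of the order of directions. *)
pose rho : 'S_d := lift_perm ord0 ord_max 1%g.
rewrite [X in _ + X](_ : _ = - \sum_(u : {ffun 'I_d -> 'I_M}) \sum_(s : 'S_d)
    (-1) ^+ s * g d u (s * rho)%g); last first.
  rewrite big_distrr -sumrN /=; apply: eq_bigr => u _; rewrite big_distrr -sumrN /=.
  rewrite (reindex_inj (mulIg rho)) /=; apply: eq_bigr => s _.
  rewrite /bump /= add1n odd_permM odd_lift_perm odd_perm1 addbF /=.
  rewrite signr_addb signr_odd exprS.
  have E : (-1) ^+ d' * (-1) ^+ d' = 1 :> R by rewrite -exprD addnn -mul2n exprM sqrrN expr1n expr1n.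
  move: E; move: ((-1) ^+ d') ((-1) ^+ s) (g _ _ _) => e t G E.
  transitivity (- (e * e) * (t * G)); first by ring.
  by rewrite E mulN1r.
apply/eqP; rewrite subr_eq0; apply/eqP.
rewrite [LHS]exchange_big [RHS]exchange_big /=; apply: eq_bigr => s _.
rewrite -!big_distrr /=; congr (_ * _).
pose x := (s^-1)%g ord0.
pose K (v : 'I_d -> nat) := f (fun j y => if y == x then v x else (v y + (s y < j.+1))%N).
rewrite (eq_bigr (fun u : {ffun 'I_d -> 'I_M} => K (fun y => (u y + (y == x))%N))); last first.
  move=> u _; congr f; apply: funext => j; apply: funext => y.
  rewrite /kuhn_vertex /bump leq0n add1n; case: (eqVneq y x) => [->|]; last by rewrite addn0.
  by rewrite /x permKV eqxx.
rewrite sum_grid_shift => [|v vx].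
  apply: eq_bigr => u _; apply: lf => j le_j; apply: funext => y.
  have -> : bump d j = j by rewrite /bump leqNgt ltnS le_j.
  rewrite /kuhn_vertex permM.
  case: (eqVneq y x) => [->|yx].
    by rewrite /x permKV lift_perm_id /= ltnNge le_j addn0.
  have: s y != ord0 by apply: contraNneq yx => sy; rewrite /x -sy permK.
  case: (unliftP ord0 (s y)) => [k ->|-> /eqP//] _.
  by rewrite lift_perm_lift perm1 lift_max /= /bump add1n ltnS.
by apply: (f0 _ x (v x)) => // j _; rewrite eqxx.
Qed.

End Kuhn.

(** * Power sums over a finite field *)

Section PowerSums.
Context {F : finFieldType}.

(** Some nonzero a has a^i <> 1, and multiplication by a permutes the terms. *)
Lemma power_sum_lt i : (i < #|F|.-1)%N -> \sum_(y : F) y ^+ i = 0.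
Proof.
case: i => [_|i lt_i].
  under eq_bigr do rewrite expr0.
  have : \sum_(y : F) y = \sum_(y : F) (y + 1) by rewrite (reindex_inj (addIr (1 : F))).
  by rewrite big_split /= => /eqP; rewrite addrC -subr_eq subrr eq_sym => /eqP.
have [a a0 ai] : exists2 a : F, a != 0 & a ^+ i.+1 != 1.
  apply/exists2P; apply: contrapT => /forallNP H.
  pose P : {poly F} := 'X^(i.+1) - 1%:P.
  have sP : size P = i.+2 by rewrite size_XnsubC.
  have := @max_poly_roots _ P (enum (predC1 (0 : F))).
  rewrite sP -cardE cardC1 ltnS -size_poly_eq0 sP => /(_ isT) lt.
  suff : (#|F|.-1 < i.+2)%N by move: lt_i; lia.
  apply: lt; last exact: enum_uniq.
  apply/allP => x; rewrite mem_enum inE => x0; rewrite rootE !hornerE.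
  by rewrite subr_eq0; apply: contrapT => xi; apply: (H x); split => //; apply/negP.
have /eqP : (a ^+ i.+1 - 1) * \sum_(y : F) y ^+ i.+1 = 0.
  rewrite mulrBl mul1r [in X in _ - X](reindex_inj (mulfI a0)) /= big_distrr /=.
  by apply/eqP; rewrite subr_eq0; apply/eqP; apply: eq_bigr => y _; rewrite exprMn.
by rewrite mulf_eq0 subr_eq0 (negPf ai) /= => /eqP.
Qed.

Lemma power_sum_top : \sum_(y : F) y ^+ #|F|.-1 = - 1.
Proof.
have q1 := finRing_gt1 F.
have := @power_sum_lt 0; under eq_bigr do rewrite expr0.
have E : \sum_(y : F) (1 : F) = 1 + \sum_(y : F | y != 0) 1 by rewrite (bigD1 0).
rewrite -subn1 subn_gt0 q1 E => /(_ isT) /eqP; rewrite addrC addr_eq0 => /eqP <-.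
rewrite (bigD1 0) //= expr0n subn_eq0 leqNgt q1 add0r; apply: eq_bigr => y y0.
apply: (mulfI y0); rewrite -exprS subn1 prednK ?expf_card ?mulr1 //.
exact: ltnW.
Qed.

Lemma sum_horner (P : {poly F}) : (size P <= #|F|)%N ->
  \sum_(y : F) P.[y] = - P`_#|F|.-1.
Proof.
have q1 : (0 < #|F|)%N by apply: ltnW; exact: finRing_gt1.
move=> sP; under eq_bigr => y _ do rewrite (horner_coef_wide y sP).
rewrite exchange_big /= -(prednK q1) big_ord_recr /= big1 ?add0r => [|i _].
  by rewrite -big_distrr /= power_sum_top mulrN1.
by rewrite -big_distrr /= power_sum_lt ?mulr0.
Qed.

Definition polyfun D (f : F -> F) := exists2 P : {poly F}, (size P <= D.+1)%N & f = horner P.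

Lemma polyfun_const D c : polyfun D (fun=> c).
Proof.
exists c%:P; first by rewrite (leq_trans (size_polyC_leq1 _)).
by apply: funext => a; rewrite hornerC.
Qed.

Lemma polyfun_id D : (0 < D)%N -> polyfun D id.
Proof.
by move=> D0; exists 'X; [rewrite size_polyX | apply: funext => a; rewrite hornerX].
Qed.

Lemma polyfunW D D' f : (D <= D')%N -> polyfun D f -> polyfun D' f.
Proof. by move=> DD' [P sP ->]; exists P => //; apply: leq_trans sP _. Qed.

Lemma polyfunB D f g : polyfun D f -> polyfun D g -> polyfun D (fun a => f a - g a).
Proof.
move=> [P sP ->] [Q sQ ->]; exists (P - Q); last by apply: funext => a; rewrite !hornerE.
by rewrite (leq_trans (size_polyD _ _)) // size_polyN geq_max sP.
Qed.

Lemma polyfunM D E f g : polyfun D f -> polyfun E g -> polyfun (D + E)%N (fun a => f a * g a).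
Proof.
move=> [P sP ->] [Q sQ ->]; exists (P * Q); last by apply: funext => a; rewrite !hornerE.
by rewrite (leq_trans (size_polyMleq _ _)) //; move: sP sQ; lia.
Qed.

Lemma polyfunX D n f : polyfun D f -> polyfun (D * n)%N (fun a => f a ^+ n).
Proof.
move=> [P sP ->]; exists (P ^+ n); last by apply: funext => a; rewrite !hornerE.
rewrite (leq_trans (size_poly_exp_leq _ _)) // ltnS leq_mul2r -subn1 leq_subLR add1n sP.
by rewrite orbT.
Qed.

Lemma polyfun_prod I (s : seq I) (D : I -> nat) (f : I -> F -> F) :
  (forall i, polyfun (D i) (f i)) ->
  polyfun (\sum_(i <- s) D i)%N (fun a => \prod_(i <- s) f i a).
Proof.
move=> pf; elim: s => [|i s IH].
  by rewrite (_ : (fun _ => _) = fun=> 1); [exact: polyfun_const | apply: funext => a; rewrite big_nil].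
rewrite big_cons (_ : (fun _ => _) = fun a => f i a * \prod_(j <- s) f j a); first exact: polyfunM.
by apply: funext => a; rewrite big_cons.
Qed.

(** Only the monomial of exponent #|F| - 1 has a nonzero sum over F. *)
Lemma polyfun_sum D f : polyfun D f -> (D < #|F|.-1)%N -> \sum_(a : F) f a = 0.
Proof.
move=> [P sP ->] ltD; have sP' := leq_trans sP ltD.
by rewrite sum_horner ?nth_default ?oppr0 // (leq_trans sP') ?leq_pred.
Qed.

Definition update (x : nat -> F) nu a : nat -> F := fun i => if i == nu then a else x i.

Lemma polyfun_update x nu i : polyfun (i == nu) (fun a => update x nu a i).
Proof. by rewrite /update; case: eqP => _; [exact: polyfun_id | exact: polyfun_const]. Qed.

(** The argument x_nu occurs linearly in m - 1 factors. *)
Lemma polyfun_vandermonde m x nu : (nu < m)%N -> polyfun m.-1 (fun a => vandermonde m (update x nu a)).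
Proof.
elim: m => [//|m IH] lt_nu /=.
have Ec : (nu = m) -> forall a, vandermonde m (update x nu a) = vandermonde m x.
  by move=> -> a; apply: eq_vandermonde => i lt_i; rewrite /update; case: eqP lt_i => // ->; rewrite ltnn.
have Hp : polyfun (\sum_(i < m) ((m == nu) || (i == nu :> nat)))%N
     (fun a => \prod_(i < m) (update x nu a m - update x nu a i)).
  apply: (@polyfun_prod _ _ (fun i : 'I_m => nat_of_bool ((m == nu) || (i == nu :> nat)))
    (fun i a => update x nu a m - update x nu a i)) => i.
  apply: polyfunB; apply: polyfunW (polyfun_update _ _ _); first by case: eqP.
  by case: (i == nu :> nat) => //; rewrite orbT.
rewrite (_ : (fun a => _) = fun a => vandermonde m (update x nu a) * \prod_(i < m) (update x nu a m - update x nu a i)); last first.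
  by apply: funext => a; rewrite vandermondeS.
move: lt_nu; rewrite ltnS leq_eqVlt => /orP[/eqP E|lt_nu].
  rewrite (_ : (fun a => _) = fun a => vandermonde m x * \prod_(i < m) (update x nu a m - update x nu a i)); last first.
    by apply: funext => a; rewrite Ec.
  apply: polyfunW (polyfunM (polyfun_const 0 _) Hp).
  by rewrite add0n E eqxx /= sum1_card card_ord.
apply: polyfunW (polyfunM (IH lt_nu) Hp).
rewrite gtn_eqF //= (eq_bigr (fun i : 'I_m => if i == Ordinal lt_nu then 1 else 0))%N; last first.
  by move=> i _; rewrite -val_eqE /=; case: eqP.
by rewrite -big_mkcond big_pred1_eq; lia.
Qed.

End PowerSums.

(** * Powers of the cocycle and the dual weight *)

Section CupPower.
Context {R : comNzRingType} {D : Type} (m : nat) (beta : nat -> D).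

Definition cup_vandermonde B (x : nat -> D -> R) : R :=
  \prod_(b < B) vandermonde m.+1 (fun j => x (b * m + j)%N (beta b)).

Lemma cup_vandermondeS B : cup_vandermonde B.+1 =
  cup (B * m) (cup_vandermonde B) (fun x => vandermonde m.+1 (fun j => x j (beta B))).
Proof. by apply: funext => x; rewrite /cup_vandermonde big_ord_recr. Qed.

Lemma local_vandermonde b : local m (fun x : nat -> D -> R => vandermonde m.+1 (fun j => x j (beta b))).
Proof. by move=> x x' E; apply: eq_vandermonde => i le_i; rewrite E. Qed.

Lemma local_cup_vandermonde B : local (B * m)%N (cup_vandermonde B).
Proof.
elim: B => [|B IH]; first by move=> x x' _; rewrite /cup_vandermonde !big_ord0.
by rewrite cup_vandermondeS mulSnr; apply: local_cup (local_vandermonde _).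
Qed.

Lemma cocycle_cup_vandermonde B : cocycle (B * m)%N (cup_vandermonde B).
Proof.
elim: B => [|B IH].
  move=> x; rewrite /coboundary !big_ord_recl big_ord0 /cup_vandermonde !big_ord0 /= /bump.
  by rewrite expr0 expr1 !mulr1 addr0 subrr.
rewrite cup_vandermondeS mulSnr; apply: cocycle_cup => //; [exact: local_cup_vandermonde | exact: local_vandermonde|].
move=> x; exact: (vandermonde_cocycle m (fun i => x i (beta B))).
Qed.

Lemma cup_vandermonde_shift B (x : nat -> D -> R) (c : D -> R) :
  cup_vandermonde B (fun i e => x i e + c e) = cup_vandermonde B x.
Proof. by apply: eq_bigr => b _; rewrite vandermonde_shift. Qed.

Lemma cup_vandermonde_repeat B (x : nat -> D -> R) j : (j < B * m)%N ->
  x j = x j.+1 -> cup_vandermonde B x = 0.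
Proof.
move=> lt_j E; have m0 : (0 < m)%N by case: m lt_j; rewrite ?muln0.
have lt_b : (j %/ m < B)%N by rewrite ltn_divLR.
rewrite /cup_vandermonde (bigD1 (Ordinal lt_b)) //= (@vandermonde_repeat _ _ _ (j %% m)%N (j %% m)%N.+1) ?mul0r //.
  by rewrite ltnS leqnn /= ltnS ltn_mod.
by rewrite addnS -div.divn_eq E.
Qed.

End CupPower.

Lemma sum_ord_eq_leq n c K : (\sum_(i < n) (if i == c :> nat then K else 0) <= K)%N.
Proof. by rewrite -big_mkcond big_ord1_eq; case: ifP. Qed.

Section Weight.
Context {F : finFieldType} (p1 r B : nat).
Hypothesis (p1_gt0 : (0 < p1)%N) (r_gt0 : (0 < r)%N).
Hypothesis cardF : #|F| = (r * p1.+1)%N.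
Local Notation d := (B * p1)%N.

Definition weight (x : nat -> F) : F :=
  \prod_(m < d) (x m.+1 - x m) ^+ r.-1 *
  (\prod_(b < B) vandermonde p1 (fun j => x (b * p1 + j)%N)) ^+ r.

Lemma weight_shift x c : weight (fun i => x i + c) = weight x.
Proof.
congr (_ * _ ^+ _); apply: eq_bigr => i _; last by rewrite vandermonde_shift.
by rewrite opprD addrACA subrr addr0.
Qed.

Lemma local_weight : local d weight.
Proof.
move=> x x' E; congr (_ * _ ^+ _); apply: eq_bigr => i _.
  by rewrite !E //; exact: ltnW.
apply: eq_vandermonde => j lt_j; apply: E; have := ltn_ord i; nia.
Qed.

(** As a function of x_nu the weight has degree at most
    2 (r - 1) + r (p - 2) = #|F| - 2: two consecutive differences contain x_nu, and
    it lies among the first p - 1 entries of at most one block. *)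
Lemma weight_line x (nu : nat) : \sum_a weight (update x nu a) = 0.
Proof.
(* Degrees in x_nu of the differences and of the blocks. *)
pose D1 m := (((m.+1 == nu) + (m == nu)) * r.-1)%N.
pose D2 b := (if b == (nu %/ p1)%N then p1.-1 else 0)%N.
have H1 : polyfun (\sum_(m < d) D1 m)%N (fun a => \prod_(m < d) (update x nu a m.+1 - update x nu a m) ^+ r.-1).
  apply: (@polyfun_prod F _ _ (fun m : 'I_d => D1 m) (fun m a => (update x nu a m.+1 - update x nu a m) ^+ r.-1)).
  move=> m; apply: (@polyfunX _ _ _ (fun a => update x nu a m.+1 - update x nu a m)); apply: polyfunB.
    by apply: polyfunW (polyfun_update _ _ _); rewrite leq_addr.
  by apply: polyfunW (polyfun_update _ _ _); rewrite leq_addl.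
have H2 : polyfun (\sum_(b < B) D2 b)%N (fun a => \prod_(b < B) vandermonde p1 (fun j => update x nu a (b * p1 + j)%N)).
  apply: (@polyfun_prod F _ _ (fun b : 'I_B => D2 b) (fun b a => vandermonde p1 (fun j => update x nu a (b * p1 + j)%N))).
  move=> b; rewrite /D2; case: (eqVneq (b : nat) (nu %/ p1)%N) => [E|nE].
    rewrite (_ : (fun a => _) = fun a => vandermonde p1 (update (fun j => x (b * p1 + j)%N) (nu %% p1)%N a)).
      by apply: polyfun_vandermonde; rewrite ltn_mod.
    apply: funext => a; apply: eq_vandermonde => i _; rewrite /update {1}(div.divn_eq nu p1) -E.
    by rewrite eqn_add2l.
  rewrite (_ : (fun a => _) = fun=> vandermonde p1 (fun j => x (b * p1 + j)%N)); first exact: polyfun_const.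
  apply: funext => a; apply: eq_vandermonde => i lt_i; rewrite /update; case: eqP => // E.
  by move: nE; rewrite -E divnMDl // divn_small // addn0 eqxx.
apply: (polyfun_sum (polyfunM H1 (polyfunX r H2))).
have S1 : (\sum_(m < d) D1 m <= 2 * r.-1)%N.
  rewrite -big_distrl leq_mul2r big_split /=; apply/orP; right.
  rewrite (leq_add (n1 := 1) (n2 := 1)) //.
    rewrite (eq_bigr (fun m : 'I_d => if m == nu.-1 :> nat then (0 < nu)%N : nat else 0%N)) => [|m _].
      by rewrite (leq_trans (sum_ord_eq_leq _ _ _)) //; case: (0 < nu)%N.
    case: (posnP nu) => [->|nu0] //; first by case: ifP.
    by rewrite -{1}(prednK nu0) eqSS; case: ifP.
  rewrite (eq_bigr (fun m : 'I_d => if m == nu :> nat then 1%N else 0%N)) ?sum_ord_eq_leq //.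
have S2 : (\sum_(b < B) D2 b <= p1.-1)%N by exact: sum_ord_eq_leq.
apply: leq_ltn_trans (leq_add S1 (leq_mul S2 (leqnn r))) _.
by rewrite cardF; case: (p1) (r) p1_gt0 r_gt0 => [//|a] [//|b] _ _ /=; nia.
Qed.

Definition weighted_sum (Psi : (nat -> F) -> F) : F :=
  list_sum d (fun s => Psi (nth 0 (0 :: s))).

(** For nu > 0 the sum over theta_nu can be performed first.  For nu = 0 translation
    invariance replaces the normalisation theta_0 = 0 by theta_1 = 0. *)
Lemma weighted_sum_eq0 (Phi : (nat -> F) -> F) nu : (0 < B)%N -> (nu <= d)%N ->
  local d Phi -> (forall x c, Phi (fun i => x i + c) = Phi x) ->
  (forall x a, Phi (update x nu a) = Phi x) ->
  weighted_sum (fun x => weight x * Phi x) = 0.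
Proof.
move=> B0 le_nu lP tP iP; pose Psi x := weight x * Phi x.
have lPsi : local d Psi by move=> x x' E; rewrite /Psi (local_weight E) (lP _ _ E).
have tPsi x c : Psi (fun i => x i + c) = Psi x by rewrite /Psi weight_shift tP.
have iPsi x : \sum_a Psi (update x nu a) = 0.
  by under eq_bigr do rewrite /Psi iP; rewrite -big_distrl /= weight_line mul0r.
change (list_sum d (fun s => Psi (nth 0 (0 :: s))) = 0); case: nu {iP} le_nu iPsi => [_|nu le_nu] iPsi; last first.
  apply: (@list_sum_line _ _ _ 0 nu) => // s ss; rewrite -[RHS](iPsi (nth 0 (0 :: s))).
  apply: eq_bigr => a _; apply: lPsi => -[|i] le_i //=.
  by rewrite nth_set_nth /= /update eqSS.
have := lPsi; move: Psi tPsi iPsi {lPsi} => Psi tPsi iPsi.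
case E : d => [|d'] lPsi; first by move: E p1_gt0 B0; lia.
rewrite /= (eq_bigr (fun y => list_sum d' (fun s => Psi (nth 0 (- y :: 0 :: s))))).
  rewrite -list_sum_bigsum -[RHS](list_sum0 (A := F) d'); apply: eq_list_sum => s ss.
  rewrite (reindex_inj oppr_inj) /= -[RHS](iPsi (nth 0 (0 :: 0 :: s))).
  by apply: eq_bigr => a _; rewrite opprK; apply: lPsi => -[|i].
move=> y _; rewrite -(@list_sum_bij _ _ _ _ (fun z => z + y)); last first.
  by exists (fun z => z - y) => z; rewrite ?addrK ?subrK.
apply: eq_list_sum => s ss; rewrite -[RHS](tPsi _ y); apply: lPsi => -[|[|i]] le_i /=.
- by rewrite addNr.
- by rewrite add0r.
- by rewrite (nth_map 0) // ss.
Qed.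

End Weight.

(** * Moments of the trace *)

Section StepSums.
Context {R : comNzRingType}.

(** A difference of two positions of a walk, written in terms of its steps s.  The
    flag selects which of two readings of a step is used, because the two kinds of
    Vandermonde factors read different functions of the same walk. *)
Definition step_form (A : Type) (x0 : A) (a b : A -> R) (l : nat * nat * bool) N (s : seq A) : R :=
  \sum_(m < N | (l.1.1 <= m < l.1.2)%N) (if l.2 then a else b) (nth x0 s m).

(** The common shape of the block sums over F and over the prime field, general
    enough to be stable under expanding one factor of the product over ls. *)
Definition step_sum (A : finType) (x0 : A) (wt a b : A -> R) N (g f : nat -> nat)
    (ls : seq (nat * nat * bool)) : R :=
  list_sum N (fun s => \prod_(m < N) (wt (nth x0 s m) * a (nth x0 s m) ^+ g m * b (nth x0 s m) ^+ f m)
     * \prod_(l <- ls) step_form x0 a b l N s).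

Definition moment (A : finType) (wt a b : A -> R) g f := \sum_y wt y * a y ^+ g * b y ^+ f.

Lemma step_sum_cons (A : finType) (x0 : A) wt a b N g f l ls :
  step_sum x0 wt a b N g f (l :: ls)
    = \sum_(m < N | (l.1.1 <= m < l.1.2)%N)
        step_sum x0 wt a b N (fun m' => g m' + (l.2 && (m' == m)))%N
                 (fun m' => f m' + (~~ l.2 && (m' == m)))%N ls.
Proof.
rewrite /step_sum -list_sum_bigsum; apply: eq_list_sum => s _.
rewrite big_cons {1}/step_form mulrA big_distrr big_distrl /=; apply: eq_bigr => m _.
rewrite mulrC [RHS]mulrC; congr (_ * _).
rewrite (bigD1 m) //= [RHS](bigD1 m) //= eqxx !andbT.
rewrite [in RHS](eq_bigr (fun m' : 'I_N => wt (nth x0 s m') * a (nth x0 s m') ^+ g m' * b (nth x0 s m') ^+ f m')).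
  by case: (l.2) => /=; rewrite ?addn0 ?addn1 !exprS; ring.
by move=> m' nm; rewrite -val_eqE /= in nm; rewrite (negPf nm) !andbF !addn0.
Qed.

(** Expand the product of differences into monomials.  The total degree is at most
    N K, so either every step carries degree exactly K, where the moments agree, or
    some step carries less, and both sides vanish. *)
Lemma step_sum_moment (A A' : finType) (x0 : A) (x0' : A') (wt a b : A -> R)
    (wt' a' b' : A' -> R) K N (g f : nat -> nat) ls :
  (forall i j, (i + j < K)%N -> moment wt a b i j = 0) ->
  (forall i j, (i + j < K)%N -> moment wt' a' b' i j = 0) ->
  (forall i j, (i + j = K)%N -> moment wt a b i j = moment wt' a' b' i j) ->
  (\sum_(m < N) (g m + f m) + size ls <= N * K)%N ->
  step_sum x0 wt a b N g f ls = step_sum x0' wt' a' b' N g f ls.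
Proof.
move=> M0 M0' MK; elim: ls g f => [|l ls IH] g f /= le.
  have E (A1 : finType) (x1 : A1) w1 a1 b1 : step_sum x1 w1 a1 b1 N g f [::] =
      \prod_(m < N) moment w1 a1 b1 (g m) (f m).
    rewrite -(list_sum_prod _ x1 (fun m y => w1 y * a1 y ^+ g m * b1 y ^+ f m)).
    by apply: eq_list_sum => s _; rewrite big_nil mulr1.
  rewrite !E; have [H|/forallPn[m]] := boolP [forall m : 'I_N, (K <= g m + f m)%N]; last first.
    by rewrite -ltnNge => lt_m; rewrite (bigD1 m) //= M0 // [RHS](bigD1 m) //= M0' // !mul0r.
  apply: eq_bigr => m _; apply: MK.
  move: le; rewrite addn0 -[N in (N * K)%N]card_ord -sum_nat_const => le.
  have Hs i : (K <= g (nat_of_ord i) + f i)%N := forallP H i.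
  have Hl : (\sum_(i < N | i != m) K <= \sum_(i < N | i != m) (g i + f i))%N.
    by apply: leq_sum => i _.
  move: le; rewrite (bigD1 m) //= [X in (_ <= X)%N](bigD1 m) //= => le.
  apply/eqP; rewrite eqn_leq Hs andbT -(leq_add2r (\sum_(i < N | i != m) K)).
  by apply: leq_trans le; rewrite leq_add2l.
rewrite !step_sum_cons; apply: eq_bigr => m _; apply: IH.
rewrite (_ : \sum_(m0 < N) _ = (\sum_(m < N) (g m + f m)).+1)%N; first by rewrite addSnnS.
rewrite (bigD1 m) //= [in RHS](bigD1 m) //= eqxx !andbT.
rewrite (eq_bigr (fun m' : 'I_N => g m' + f m')%N); first by case: (l.2) => /=; lia.
by move=> m' nm; rewrite -val_eqE /= in nm; rewrite (negPf nm) !andbF !addn0.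
Qed.

End StepSums.

Section Trace.
Context {F : finFieldType} (p k : nat).
Hypothesis (p_pr : prime p) (charF : p \in [pchar F]).

(** The trace of F over its prime subfield. *)
Definition trace (y : F) : F := \sum_(j < k) y ^+ (p ^ j).

Lemma traceD : {morph trace : x y / x + y}.
Proof.
move=> x y; rewrite /trace -big_split /=; apply: eq_bigr => j _.
by rewrite exprDn_pchar // (eq_pnat _ (pcharf_eq charF)) pnatX pnat_id.
Qed.

Lemma trace0 : trace 0 = 0.
Proof. by have := traceD 0 0; rewrite addr0 => /eqP; rewrite -subr_eq subrr eq_sym => /eqP. Qed.

Lemma traceB : {morph trace : x y / x - y}.
Proof.
by move=> x y; apply/eqP; rewrite eq_sym subr_eq -traceD subrK.
Qed.

Definition trace_poly : {poly F} := \sum_(j < k) 'X^(p ^ j).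

Lemma horner_trace y : trace_poly.[y] = trace y.
Proof. by rewrite horner_sum; apply: eq_bigr => j _; rewrite !hornerE. Qed.

Hypothesis (k_gt0 : (0 < k)%N).
Local Notation r := (p ^ k.-1)%N.

Lemma trace_poly_monic : trace_poly \is monic /\ size trace_poly = r.+1.
Proof.
have p1 := prime_gt1 p_pr.
rewrite /trace_poly; case: k k_gt0 => // k' _; rewrite big_ord_recr /=.
have lt : (size ((\sum_(j < k') 'X^(p ^ j))%R : {poly F}) < size (('X^(p ^ k'))%R : {poly F}))%N.
  rewrite size_polyXn ltnS (leq_trans (size_sum _ _ _)) //.
  by apply/bigmax_leqP => j _; rewrite size_polyXn ltn_exp2l.
by rewrite addrC monicE lead_coefDl // lead_coefXn eqxx size_polyDl // size_polyXn.
Qed.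

Hypothesis (cardF : #|F| = (p ^ k)%N).

Lemma trace_frob y : trace y ^+ p = trace y.
Proof.
rewrite /trace; case: k k_gt0 cardF => // k' _ cF.
rewrite -(pFrobenius_autE charF) rmorph_sum /= big_ord_recr big_ord_recl /= addrC.
congr (_ + _).
  by rewrite pFrobenius_autE -exprM -expnSr -cF expf_card expn0 expr1.
by apply: eq_bigr => i _; rewrite pFrobenius_autE -exprM -expnSr.
Qed.

(** The summand is a monic polynomial of degree r - 1 + r (i + j), which reaches the
    critical exponent #|F| - 1 exactly when i + j = p - 1. *)
Lemma trace_moment i j : (i + j <= p.-1)%N ->
  moment (fun y => y ^+ r.-1) (fun y => y ^+ r) trace i j = - (i + j == p.-1)%N%:R.
Proof.
move=> le; have [mT sT] := trace_poly_monic.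
have p1 := prime_gt1 p_pr; have r0 : (0 < r)%N by rewrite expn_gt0 ltnW.
pose P : {poly F} := 'X^(r.-1) * ('X^r) ^+ i * trace_poly ^+ j.
have m1 : ('X^(r.-1) : {poly F}) \is monic by apply: monicXn.
have m2 : (('X^r) ^+ i : {poly F}) \is monic by apply/monic_exp/monicXn.
have m3 : trace_poly ^+ j \is monic by apply: monic_exp.
have m12 : ('X^(r.-1) * ('X^r) ^+ i : {poly F}) \is monic by rewrite monicMl.
have mP : P \is monic by rewrite monicMl.
have sP : size P = (r.-1 + r * (i + j)).+1.
  rewrite size_Mmonic ?monic_neq0 // size_Mmonic ?monic_neq0 //.
  rewrite -exprM !size_polyXn -[size (trace_poly ^+ j)]prednK ?size_poly_gt0 ?monic_neq0 //.
  by rewrite size_exp sT /= mulnDr; lia.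
rewrite /moment (eq_bigr (fun y => P.[y])); last first.
  by move=> y _; rewrite /P !hornerE horner_trace.
have qE : #|F| = (r * p)%N by rewrite cardF -expnSr prednK.
have rpE : (r * p = r * p.-1 + r)%N by rewrite -mulnSr prednK // ltnW.
have le_r : (r * (i + j) <= r * p.-1)%N by rewrite leq_mul2l le orbT.
rewrite sum_horner ?sP ?qE; last by move: rpE le_r r0; lia.
congr (- _); case: eqP => [E|nE].
  transitivity (lead_coef P); last exact: (monicP mP).
  rewrite /lead_coef sP E; congr (_`_ _); move: rpE r0; lia.
have lt_r : (r * (i + j) < r * p.-1)%N by rewrite ltn_mul2l r0 ltn_neqAle le andbT; apply/eqP.
rewrite nth_default // sP; move: rpE lt_r r0; lia.
Qed.

End Trace.

(** * Walks in the prime field *)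

(** Adding the letters in front of U, each new letter has one choice less. *)
Lemma list_sum_uniq (A : finType) (R : comNzRingType) N (U : seq A) : uniq U ->
  list_sum N (fun s => (uniq (catrev s U))%:R) = ((#|A| - size U) ^_ N)%:R :> R.
Proof.
elim: N U => [|N IH] U uU /=; first by rewrite uU ffactn0.
rewrite (bigID (mem U)) /= [X in X + _]big1 ?add0r => [|y yU]; last first.
  rewrite -[RHS](list_sum0 (A := A) N); apply: eq_list_sum => s _.
  by rewrite catrevE cat_uniq /= yU !andbF.
rewrite (eq_bigr (fun=> ((#|A| - (size U).+1) ^_ N)%:R)) => [|y yU]; last first.
  by rewrite IH //= yU.
rewrite sumr_const ffactnS natrM mulr_natl subnS; congr (_%:R *+ _).
by rewrite -(card_uniqP uU) -(cardC (mem U)) addKn; apply: eq_card.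
Qed.

Section PrimeWalk.
Context {F : finFieldType} (p1 : nat).
Local Notation p := p1.+1.
Hypothesis (p_pr : prime p) (charF : p \in [pchar F]).

Definition prime_elt (z : 'F_p) : F := (z : nat)%:R.

Lemma prime_eltD : {morph prime_elt : x y / x + y}.
Proof.
move=> x y; rewrite /prime_elt /= -natrD -[RHS](GRing.natr_mod_pchar charF).
by congr (_ %:R); congr modn; exact: Fp_cast p_pr.
Qed.

Lemma prime_eltB : {morph prime_elt : x y / x - y}.
Proof. by move=> x y; apply/eqP; rewrite eq_sym subr_eq -prime_eltD subrK. Qed.

Lemma prime_elt_eq0 z : (prime_elt z == 0) = (z == 0).
Proof.
rewrite /prime_elt -(dvdn_pcharf charF); have lt : (z < p)%N by rewrite -[X in (_ < X)%N](Fp_cast p_pr).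
by rewrite /dvdn modn_small.
Qed.

Lemma prime_moment i j : (i + j <= p1)%N ->
  moment (fun=> 1) prime_elt prime_elt i j = - (i + j == p1)%N%:R.
Proof.
move=> le; rewrite /moment; under eq_bigr do rewrite mul1r -exprD.
set e := (i + j)%N.
have E (K : nzRingType) : \sum_(z : 'F_p) ((z : nat)%:R : K) ^+ e = (\sum_(0 <= z < p) z ^ e)%N%:R.
  rewrite natr_sum -(big_mkord xpredT (fun z => (z%:R : K) ^+ e)) Fp_cast //.
  by apply: eq_bigr => z _; rewrite natrX.
have EF : (\sum_(0 <= z < p) z ^ e)%N%:R = - (e == p1)%N%:R :> 'F_p.
  rewrite -E; under eq_bigr do rewrite natr_Zp.
  have q1 : #|'F_p|.-1 = p1 by rewrite card_Fp.
  case: eqP => [->|ne]; first by rewrite -[RHS](@power_sum_top 'F_p) q1.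
  by rewrite power_sum_lt ?oppr0 // q1 ltn_neqAle le andbT; apply/eqP.
rewrite /prime_elt E; apply/eqP; rewrite -subr_eq0 opprK -natrD -(dvdn_pcharf charF).
by rewrite (dvdn_pcharf (pchar_Fp p_pr)) natrD EF addNr.
Qed.

Let bijection_value := vandermonde p (fun i => i%:R : F) ^+ 2 / \prod_(z : 'F_p | z != 0) prime_elt z.

Lemma vandermonde_neq0 m (x : nat -> F) : (forall i j, (i < j < m)%N -> x i != x j) -> vandermonde m x != 0.
Proof.
move=> H; apply/prodf_neq0 => j _; apply/prodf_neq0 => i _.
by rewrite subr_eq0 eq_sym H ?ltn_ord.
Qed.

Lemma bijection_value_neq0 : bijection_value != 0.
Proof.
rewrite mulf_neq0 ?invr_neq0 //; last by apply/prodf_neq0 => z; rewrite prime_elt_eq0.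
rewrite expf_neq0 // vandermonde_neq0 // => i j /andP[ij jp]; rewrite eq_sym -subr_eq0 -natrB ?(ltnW ij) //.
rewrite -(dvdn_pcharf charF) gtnNdvd ?subn_gt0 //.
by rewrite (leq_ltn_trans (leq_subr _ _)).
Qed.

(** The product of the two sides with prod_(i < p1) (x_p1 - x_i) is the square of a
    Vandermonde determinant.  The square does not see the order of the rows, and the
    extra factor is the product of all nonzero elements of the prime field. *)
Lemma vandermonde_prime_walk (s : seq 'F_p) : size s = p1 ->
  let x := fun i => prime_elt (nth 0 (0 :: s) i) in
  vandermonde p1 x * vandermonde p x = bijection_value * (uniq (0 :: s))%:R.
Proof.
move=> ss x; case: (boolP (uniq _)) => [us|nus]; last first.
  have [i [j [ij jp E]]] : exists i j, [/\ (i < j)%N, (j < p)%N & x i = x j].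
    move: nus => /(uniqPn 0)[i [j [ij jp E]]]; exists i, j.
    by split => //; [move: jp; rewrite /= ss | rewrite /x E].
  by rewrite (@vandermonde_repeat _ p x i j) ?ij // !mulr0.
rewrite mulr1 /bijection_value; pose f (i : 'I_p) : 'F_p := nth 0 (0 :: s) i.
have fi : injective f.
  move=> i j /eqP; rewrite nth_uniq //= ?ss ?ltn_ord //.
  by move/eqP; exact: val_inj.
have fb : bijective f by apply: (inj_card_bij fi); rewrite card_Fp // card_ord.
have gi : injective (fun i => cast_ord (Fp_cast p_pr) (f i)).
  by move=> i j /cast_ord_inj /fi.
pose sg : 'S_p := perm gi.
have V2 : vandermonde p x ^+ 2 = vandermonde p (fun i => i%:R : F) ^+ 2.
  rewrite !vandermonde_det (_ : \matrix_(i, j) x i ^+ j = row_perm sg (\matrix_(i < p, j < p) (i%:R : F) ^+ j)).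
    by rewrite row_permE detM det_perm exprMn sqrr_sign mul1r.
  by apply/matrixP => i j; rewrite !mxE permE.
have Pr : \prod_(i < p1) (x p1 - x i) = \prod_(z : 'F_p | z != 0) prime_elt z.
  transitivity (\prod_(i < p | i != ord_max) prime_elt (f ord_max - f i)).
    rewrite [RHS]big_mkcond big_ord_recr /= eqxx mulr1; apply: eq_bigr => i _.
    by rewrite -val_eqE /= ltn_eqF //= prime_eltB.
  transitivity (\prod_(z | z != f ord_max) prime_elt (f ord_max - z)).
    rewrite [RHS](reindex f) /=; last exact: onW_bij.
    by apply: eq_bigl => i; rewrite (inj_eq fi).
  rewrite (reindex_inj (@subrI _ (f ord_max))) /=.
  apply: eq_big => [z|z _]; last by rewrite subKr.
  by rewrite -subr_eq0 addrAC subrr add0r oppr_eq0.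
rewrite -V2 -Pr; have nz : \prod_(i < p1) (x p1 - x i) != 0.
  by rewrite Pr; apply/prodf_neq0 => z; rewrite prime_elt_eq0.
by apply: (mulIf nz); rewrite divfK // mulrAC -vandermondeS expr2.
Qed.

(** All nonzero terms are equal and there are (p-1)! of them, a number prime to p by
    Wilson's theorem. *)
Lemma prime_walk_sum :
  list_sum p1 (fun s : seq 'F_p => let x := fun i => prime_elt (nth 0 (0 :: s) i) in
     vandermonde p1 x * vandermonde p x) != 0.
Proof.
rewrite (eq_list_sum (Psi' := fun s => bijection_value * (uniq (catrev s [:: 0]))%:R)); last first.
  move=> s ss; have /= -> := vandermonde_prime_walk ss; congr (_ * (nat_of_bool _)%:R).
  by rewrite catrevE -[RHS]rev_uniq rev_cat revK.
rewrite (list_sumZ p1 bijection_value (fun s : seq 'F_p => (uniq (catrev s [:: 0]))%:R)).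
rewrite list_sum_uniq // mulf_neq0 ?bijection_value_neq0 // card_Fp //= subn1 /= ffactnn.
rewrite -(dvdn_pcharf charF); apply/negP => dv.
have W : (p %| (p1`!).+1)%N by rewrite -(Wilson (prime_gt1 p_pr)).
by have := dvdn_sub W dv; rewrite subSnn dvdn1 => /eqP E; move: p_pr; rewrite E.
Qed.

End PrimeWalk.

(** * The pairing of the weight with the cocycle *)

Lemma nth_scanl_sum (A : zmodType) (c : A) s i : (i <= size s)%N ->
  nth 0 (c :: scanl +%R c s) i = c + \sum_(m < i) nth 0 s m.
Proof.
elim: s c i => [|y s IH] c [|i] //= le_i; rewrite ?big_ord0 ?addr0 //.
by rewrite big_ord_recl /= addrA -IH.
Qed.

(** The blocks share their end points, but translation invariance makes the sum over
    one block independent of its starting point. *)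
Lemma list_sum_blocks (F : finZmodType) (R : comNzRingType) m (G : nat -> (nat -> F) -> R) B :
  (forall b, local m (G b)) -> (forall b x c, G b (fun i => x i + c) = G b x) ->
  list_sum (B * m)%N (fun s => \prod_(b < B) G b (fun j => nth 0 (0 :: s) (b * m + j)%N))
    = \prod_(b < B) list_sum m (fun s => G b (nth 0 (0 :: s))).
Proof.
move=> lG tG; elim: B => [|B IH]; first by rewrite /= !big_ord0.
rewrite mulSnr list_sum_cat [RHS]big_ord_recr /= -IH mulrC -list_sumZ.
apply: eq_list_sum => s ss.
transitivity (list_sum m (fun t => \prod_(b < B) G b (fun j => nth 0 (0 :: s) (b * m + j)%N)
                * G B (nth 0 (last 0 s :: t)))).
  apply: eq_list_sum => t st; rewrite big_ord_recr /=; congr (_ * _).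
    apply: eq_bigr => b _; apply: lG => i le_i; rewrite -[_ :: s ++ t]cat_cons nth_cat /= ss ifT //.
    have : (b.+1 * m <= B * m)%N by rewrite leq_mul2r ltn_ord orbT.
    rewrite mulSn; lia.
  apply: lG => i le_i; rewrite -[_ :: s ++ t]cat_cons nth_cat /= ss.
  case: i le_i => [|i] le_i /=.
    by rewrite addn0 ltnSn -ss (last_nth 0).
  rewrite ifF; last lia.
  by rewrite (_ : (B * m + i.+1 - (B * m).+1 = i)%N) //; lia.
rewrite list_sumZ mulrC; congr (_ * _).
rewrite -(@list_sum_bij _ _ _ _ (fun z => z + last 0 s)); last first.
  by exists (fun z => z - last 0 s) => z; rewrite ?addrK ?subrK.
apply: eq_list_sum => t st; rewrite -[RHS](tG _ _ (last 0 s)); apply: lG => -[|i] le_i /=.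
  by rewrite add0r.
by rewrite (nth_map 0) // st.
Qed.

(** The pairs i < j < m, as the time intervals of [step_form]. *)
Definition diff_forms m (c : bool) : seq (nat * nat * bool) :=
  [seq (i, j, c) | j <- iota 0 m, i <- iota 0 j].

Lemma size_diff_forms m c : (size (diff_forms m c)).*2 = (m * m.-1)%N.
Proof.
rewrite size_allpairs_dep; under eq_map do rewrite size_iota.
rewrite map_id sumnE; elim: m => [|m IH]; first by rewrite big_nil.
rewrite -[m.+1]addn1 iotaD big_cat big_seq1 /= doubleD IH add0n addn1 /=.
by case: m {IH} => //= m; rewrite -mul2n; lia.
Qed.

Lemma vandermonde_steps (F : finZmodType) (R : comNzRingType) (g : F -> R) (a b : F -> R) c N ys m :
  {morph g : x y / x + y} -> (if c then a else b) = g -> (m <= N.+1)%N -> size ys = N ->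
  vandermonde m (fun i => g (nth 0 (0 :: scanl +%R 0 ys) i))
    = \prod_(l <- diff_forms m c) step_form 0 a b l N ys.
Proof.
move=> gD gE le_m sy.
have g0 : g 0 = 0 by have /eqP := gD 0 0; rewrite addr0 -subr_eq subrr eq_sym => /eqP.
have iotaE n (f : nat -> R) : \prod_(j <- iota 0 n) f j = \prod_(j < n) f j.
  by rewrite -(big_mkord xpredT f) /index_iota subn0.
rewrite /diff_forms big_allpairs_dep iotaE; apply: eq_bigr => j _; rewrite iotaE.
apply: eq_bigr => i _; have := ltn_ord i; have := ltn_ord j => jm ij.
rewrite !nth_scanl_sum ?sy; try lia.
rewrite !add0r !(big_morph g gD g0) /step_form /= gE.
pose h k := g (nth 0 ys k).
have W n : (n <= N)%N -> \sum_(k < n) h k = \sum_(k < N | (k < n)%N) h k.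
  exact: big_ord_widen.
rewrite W; last lia.
rewrite (W i); last lia.
rewrite (bigID (fun k : 'I_N => (k < i)%N)) /= addrAC.
rewrite (eq_bigl (fun k : 'I_N => (k < i)%N)) => [|k]; last by lia.
rewrite subrr add0r; apply: eq_bigl => k; lia.
Qed.

Section BlockValue.
Context {F : finFieldType} (p1 k : nat).
Local Notation p := p1.+1.
Local Notation r := (p ^ k.-1)%N.
Hypothesis (p_pr : prime p) (charF : p \in [pchar F]) (k_gt0 : (0 < k)%N).
Hypothesis (cardF : #|F| = (p ^ k)%N).
Local Notation trace := (@trace F p k).

(** The factor that one block contributes to the weight times the cocycle. *)
Definition block_fun (alpha : F) (y : nat -> F) : F :=
  \prod_(m < p1) (y m.+1 - y m) ^+ r.-1 * (vandermonde p1 y) ^+ r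
    * vandermonde p (fun j => trace (alpha * y j)).

Lemma frobD : {morph (fun x : F => x ^+ r) : x y / x + y}.
Proof.
by move=> x y; rewrite exprDn_pchar // (eq_pnat _ (pcharf_eq charF)) pnatX pnat_id.
Qed.

Lemma vandermonde_frob m (x : nat -> F) : vandermonde m x ^+ r = vandermonde m (fun i => x i ^+ r).
Proof.
rewrite /vandermonde -prodrXl; apply: eq_bigr => j _; rewrite -prodrXl; apply: eq_bigr => i _.
by apply/eqP; rewrite eq_sym subr_eq -frobD subrK.
Qed.

(** There are p1 (p1 - 1) / 2 + p (p - 1) / 2 = p1 ^ 2 differences, which is the
    number p1 of steps times the critical degree p1, so that the sum only depends on
    moments and can be taken in the prime field. *)
Lemma block_sum1_neq0 : list_sum p1 (fun s => block_fun 1 (nth 0 (0 :: s))) != 0.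
Proof.
pose ls := diff_forms p1 true ++ diff_forms p false.
have sls : (size ls = p1 * p1)%N.
  apply: double_inj; rewrite size_cat doubleD !size_diff_forms /=.
  by case: (p1) => //= m; rewrite -mul2n; lia.
have -> : list_sum p1 (fun s => block_fun 1 (nth 0 (0 :: s))) =
    step_sum (0 : F) (fun y => y ^+ r.-1) (fun y => y ^+ r) trace p1 (fun=> 0%N) (fun=> 0%N) ls.
  rewrite (list_sum_steps _ 0); apply: eq_list_sum => ys sy.
  rewrite /block_fun vandermonde_frob big_cat -mulrA; congr (_ * _).
    apply: eq_bigr => m _; rewrite !expr0 !mulr1; congr (_ ^+ _).
    by rewrite !nth_scanl_sum ?sy ?(ltnW (ltn_ord m)) // !add0r big_ord_recr /= addrAC subrr add0r.
  congr (_ * _).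
    by rewrite -(@vandermonde_steps _ _ (fun x => x ^+ r)) //; exact: frobD.
  rewrite -(@vandermonde_steps _ _ trace) //; last exact: traceD.
  by apply: eq_vandermonde => i _; rewrite mul1r.
rewrite (@step_sum_moment _ _ _ 0 (0 : 'F_p) _ _ _ (fun=> 1) (@prime_elt F p1) (@prime_elt F p1) p1).
- have -> : step_sum (0 : 'F_p) (fun=> 1) (@prime_elt F p1) (@prime_elt F p1) p1 (fun=> 0%N) (fun=> 0%N) ls
      = list_sum p1 (fun s : seq 'F_p => let x := fun i => @prime_elt F p1 (nth 0 (0 :: s) i) in
            vandermonde p1 x * vandermonde p x).
    rewrite [RHS](list_sum_steps _ 0); apply: eq_list_sum => ys sy /=.
    rewrite big1 => [|m _]; last by rewrite !expr0 !mulr1.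
    rewrite mul1r big_cat /=; congr (_ * _);
      by rewrite -(@vandermonde_steps _ _ (@prime_elt F p1)) //; exact: prime_eltD.
  exact: prime_walk_sum.
- move=> i j lt; have := trace_moment p_pr charF k_gt0 cardF (ltnW lt).
  by rewrite (ltn_eqF lt) oppr0.
- by move=> i j lt; have := prime_moment p_pr charF (ltnW lt); rewrite (ltn_eqF lt) oppr0.
- move=> i j E; have le : (i + j <= p1)%N by rewrite E.
  have := trace_moment p_pr charF k_gt0 cardF le.
  by have := prime_moment p_pr charF le; rewrite E => -> ->.
- by rewrite big1 // add0n sls.
Qed.

Lemma local_block alpha : local p1 (block_fun alpha).
Proof.
move=> x x' E; rewrite /block_fun; congr (_ * _ ^+ _ * _).
- by apply: eq_bigr => m _; rewrite !E // ltnW.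
- by apply: eq_vandermonde => i /ltnW; exact: E.
- by apply: eq_vandermonde => i lt_i; rewrite E.
Qed.

Lemma block_shift alpha x c : block_fun alpha (fun i => x i + c) = block_fun alpha x.
Proof.
rewrite /block_fun vandermonde_shift; congr (_ * _ * _).
  by apply: eq_bigr => m _; rewrite opprD addrACA subrr addr0.
rewrite -(vandermonde_shift p (fun j => trace (alpha * x j)) (trace (alpha * c))).
by apply: eq_vandermonde => i _; rewrite mulrDr traceD.
Qed.

Lemma vandermonde_scale m (x : nat -> F) c :
  vandermonde m (fun i => c * x i) = c ^+ (\sum_(j < m) j) * vandermonde m x.
Proof.
rewrite -prodrXr /vandermonde -big_split /=; apply: eq_bigr => j _.
rewrite -[X in c ^+ X]card_ord -prodr_const -big_split /=.
by apply: eq_bigr => i _; rewrite mulrBr.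
Qed.

(** The substitution y -> alpha y reduces to alpha = 1, up to a power of alpha. *)
Lemma block_sum_neq0 alpha : alpha != 0 ->
  list_sum p1 (fun s => block_fun alpha (nth 0 (0 :: s))) != 0.
Proof.
(* The factor by which the block weight scales. *)
move=> a0; pose e : F := \prod_(m < p1) alpha ^+ r.-1 * (alpha ^+ (\sum_(j < p1) j)) ^+ r.
have E y : block_fun 1 (fun i => alpha * y i) = e * block_fun alpha y.
  rewrite /block_fun vandermonde_scale exprMn (eq_bigr (fun m : 'I_p1 => alpha ^+ r.-1 * (y m.+1 - y m) ^+ r.-1)).
    rewrite big_split /= /e (@eq_vandermonde _ p (fun j => trace (1 * (alpha * y j))) (fun j => trace (alpha * y j))); last by move=> i _; rewrite mul1r.
    by rewrite mulrACA !mulrA.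
  by move=> m _; rewrite -mulrBr exprMn.
suff : e * list_sum p1 (fun s => block_fun alpha (nth 0 (0 :: s))) != 0.
  by apply: contraNneq => ->; rewrite mulr0.
rewrite -list_sumZ; have := block_sum1_neq0; rewrite -(@list_sum_bij _ _ _ _ (fun z => alpha * z)); last first.
  by exists (fun z => alpha^-1 * z) => z; rewrite ?mulKf ?mulVKf.
congr (_ != _); apply: eq_list_sum => s ss; rewrite -E; apply: local_block => -[|i] le_i /=.
  by rewrite mulr0.
by rewrite (nth_map 0) // ss.
Qed.

Lemma weighted_sum_cup_neq0 B (alpha : nat -> F) : (forall b, alpha b != 0) ->
  weighted_sum p1 B (fun x => weight p1 r B x *
     cup_vandermonde p1 alpha B (fun j a => trace (a * x j))) != 0.
Proof.
move=> a0; rewrite /weighted_sum (eq_list_sum (Psi' := fun s =>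
  \prod_(b < B) block_fun (alpha b) (fun j => nth 0 (0 :: s) (b * p1 + j)%N))); last first.
  move=> s _; move: (nth 0 _) => x; rewrite /weight /cup_vandermonde -prodrXl !big_split /=.
  congr (_ * _ * _); elim: B => [|B IH]; first by rewrite !big_ord0.
  by rewrite mulSnr big_split_ord /= IH [RHS]big_ord_recr /=; congr (_ * _);
     apply: eq_bigr => i _; rewrite addnS.
rewrite (list_sum_blocks _ (fun b => @local_block (alpha b))).
  by apply/prodf_neq0 => b _; exact: block_sum_neq0.
by move=> b x c; exact: block_shift.
Qed.

End BlockValue.

(** * Labelled grids *)

(** A permutation preserves the sum of the indices. *)
Lemma perm_ge_id n (s : 'S_n) : (forall i : 'I_n, (i <= s i)%N) -> s = 1%g.
Proof.
move=> le; apply/permP => i; rewrite perm1; apply/val_inj/eqP.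
rewrite eqn_leq le andbT leqNgt; apply/negP => lt.
have : (\sum_(j < n) j < \sum_(j < n) s j)%N.
  rewrite (bigD1 i) //= [X in (_ < X)%N](bigD1 i) //= -addSn leq_add //.
  by apply: leq_sum => j _; exact: le.
by rewrite [X in (X < _)%N](reindex_inj (@perm_inj _ s)) /= ltnn.
Qed.

Section FirstZero.
Context (d : nat).
Implicit Types (v : 'I_d -> nat).

Definition first_zero v : nat := find (fun m => v m == 0%N) (enum 'I_d).

Lemma first_zero_leq v : (first_zero v <= d)%N.
Proof. by rewrite -[X in (_ <= X)%N]card_ord cardE find_size. Qed.

Lemma first_zero_eq0 v (m : 'I_d) : m = first_zero v :> nat -> v m = 0%N.
Proof.
move=> E; have lt : (find (fun m => v m == 0%N) (enum 'I_d) < size (enum 'I_d))%N.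
  by rewrite -/(first_zero v) -E -cardE card_ord.
have := lt; rewrite -has_find => /(nth_find m) /=.
by rewrite -/(first_zero v) -E nth_ord_enum => /eqP.
Qed.

Lemma first_zero_gt v (m : 'I_d) : (m < first_zero v)%N -> v m != 0%N.
Proof. by move=> /(before_find m); rewrite nth_ord_enum => ->. Qed.

Lemma first_zeroP v j : (j <= d)%N -> (forall m : 'I_d, (m < j)%N -> v m != 0%N) ->
  (forall m : 'I_d, m = j :> nat -> v m = 0%N) -> first_zero v = j.
Proof.
move=> jd lt0 eq0; case: (ltngtP (first_zero v) j) => // H.
  have hd : (first_zero v < d)%N by exact: leq_trans H jd.
  by have := lt0 (Ordinal hd) H; rewrite (@first_zero_eq0 v (Ordinal hd)).
have hd : (j < d)%N by exact: leq_trans H (first_zero_leq v).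
by have := @first_zero_gt v (Ordinal hd) H; rewrite eq0.
Qed.

Lemma first_zero_mono v v' : (forall m, (v m <= v' m)%N) -> (first_zero v <= first_zero v')%N.
Proof. by move=> le; apply: sub_find => m /eqP v'0; rewrite -leqn0 -v'0. Qed.

End FirstZero.

Section Labelling.
Context {F : finFieldType} {D : Type} (p1 k B M d' : nat).
Local Notation p := p1.+1.
Local Notation r := (p ^ k.-1)%N.
Local Notation d := d'.+1.
Hypothesis (p_pr : prime p) (charF : p \in [pchar F]) (k_gt0 : (0 < k)%N).
Hypothesis (cardF : #|F| = (p ^ k)%N).
Hypothesis (dE : (B * p1)%N = d) (M_gt0 : (0 < M)%N).
Context (beta : nat -> D) (alpha : D -> F).
Hypothesis alpha_neq0 : forall e, alpha e != 0.
Local Notation trace := (@trace F p k).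
Local Notation cupv := (@cup_vandermonde F D p1 beta B).

(** The indices whose cell can have positive measure at the vertex v.  Each facet of
    the cube makes one index inactive. *)
Definition active (v : 'I_d -> nat) (nu : nat) :=
  forall m : 'I_d, (m = nu :> nat -> v m != M) /\ (m.+1 = nu -> v m != 0%N).

Definition equivariant_label (lab : ('I_d -> nat) -> (nat -> F) -> D -> F) :=
  (forall v x x', (forall nu, (nu <= d)%N -> active v nu -> x nu = x' nu) ->
       lab v x = lab v x') /\
  (forall v x c e, lab v (fun i => x i + c) e = lab v x e + trace (alpha e * c)).

(** A labelling for which a single simplex contributes to the sum. *)
Definition canonical_label (v : 'I_d -> nat) (x : nat -> F) (e : D) : F :=
  trace (alpha e * x (first_zero v)).

Lemma active_first_zero v : active v (first_zero v).
Proof.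
move=> m; split => E; last by apply: first_zero_gt; rewrite -E.
by rewrite (first_zero_eq0 E) eq_sym -lt0n.
Qed.

Lemma equivariant_canonical : equivariant_label canonical_label.
Proof.
split=> [v x x' E|v x c e]; last by rewrite /canonical_label mulrDr (traceD k p_pr charF).
apply: funext => e; rewrite /canonical_label E ?first_zero_leq //.
exact: active_first_zero.
Qed.

Definition label_sum (lab : ('I_d -> nat) -> (nat -> F) -> D -> F) x : F :=
  \sum_(u : {ffun 'I_d -> 'I_M}) \sum_(s : 'S_d)
     (-1) ^+ s * cupv (fun j => lab (kuhn_vertex u s j) x).

(** Along a Kuhn simplex the first zero coordinate is weakly increasing, and two equal
    consecutive labels make the cocycle vanish.  So it must be j at the j-th vertex for
    every j, which forces the simplex at the origin with the identity order. *)
Lemma label_sum_canonical x :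
  label_sum canonical_label x = cupv (fun j e => trace (alpha e * x j)).
Proof.
pose u0 : {ffun 'I_d -> 'I_M} := [ffun=> Ordinal M_gt0].
have cup0 (u : {ffun 'I_d -> 'I_M}) (s : 'S_d) : (u != u0) || (s != 1%g) ->
    cupv (fun j => canonical_label (kuhn_vertex u s j) x) = 0.
  move=> us; apply/eqP; apply: contraT => nz.
  pose fz j := first_zero (kuhn_vertex u s j).
  have fzS j : (j < d)%N -> (fz j < fz j.+1)%N.
    move=> lt_j; rewrite ltn_neqAle; apply/andP; split; last first.
      by apply: first_zero_mono => m; rewrite leq_add2l; lia.
    apply: contraNneq nz => E; apply/eqP; apply: (@cup_vandermonde_repeat _ _ _ _ _ _ j); first by rewrite dE.
    by apply: funext => e; rewrite /canonical_label -/(fz j) E.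
  have ge_fz j : (j <= d)%N -> (j <= fz j)%N.
    elim: j => // j IH lt_j; exact: leq_ltn_trans (IH (ltnW lt_j)) (fzS _ lt_j).
  have le_fz j : (j <= d)%N -> (fz (d - j) <= d - j)%N.
    elim: j => [_|j IH lt_j]; first by rewrite subn0 first_zero_leq.
    have E : ((d - j.+1).+1 = d - j)%N by rewrite subnSK.
    rewrite -ltnS E; apply: leq_trans (IH (ltnW lt_j)); rewrite -E; apply: fzS.
    by rewrite E leq_subr.
  have fzE (j : 'I_d) : fz j = j.
    apply/eqP; rewrite eqn_leq ge_fz ?(ltnW (ltn_ord j)) // andbT.
    by have := le_fz (d - j)%N (leq_subr _ _); rewrite subKn // ltnW.
  have v0 (j : 'I_d) : kuhn_vertex u s j j = 0%N.
    by apply: first_zero_eq0; rewrite -/(fz j) fzE.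
  move: us; rewrite (_ : u = u0) ?eqxx /=; last first.
    apply/ffunP => j; apply: val_inj; rewrite !ffunE /=.
    by have /eqP := v0 j; rewrite addn_eq0 => /andP[/eqP].
  rewrite (_ : s = 1%g) ?eqxx //; apply: perm_ge_id => j.
  by have /eqP := v0 j; rewrite /kuhn_vertex addn_eq0 eqb0 -leqNgt => /andP[].
rewrite /label_sum (bigD1 u0) //= [X in _ + X]big1 ?addr0; last first.
  by move=> u nu; apply: big1 => s _; rewrite cup0 ?nu ?mulr0.
rewrite (bigD1 1%g) //= [X in _ + X]big1 ?addr0; last first.
  by move=> s ns; rewrite cup0 ?ns ?orbT ?mulr0.
rewrite odd_perm1 expr0 mul1r; apply: local_cup_vandermonde => j; rewrite dE => le_j.
apply: funext => e; rewrite /canonical_label (@first_zeroP _ _ j) // => m.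
  by move=> lt; rewrite /kuhn_vertex perm1 lt addn1.
by move=> E; rewrite /kuhn_vertex perm1 E ltnn !ffunE.
Qed.

(** The difference is the sum of the coboundary of the prism cochain.  On a facet of
    the cube one index is inactive, so the prism cochain does not depend on the
    corresponding theta_nu and the weighted sum annihilates it. *)
Lemma weighted_label_sum_invariant (lab lab' : ('I_d -> nat) -> (nat -> F) -> D -> F) :
  equivariant_label lab -> equivariant_label lab' ->
  weighted_sum p1 B (fun x => weight p1 r B x * label_sum lab x)
    = weighted_sum p1 B (fun x => weight p1 r B x * label_sum lab' x).
Proof.
move=> [ext sh] [ext' sh']; apply/eqP; rewrite -subr_eq0; apply/eqP.
pose f (x : nat -> F) (v : nat -> 'I_d -> nat) : F :=
  prism d cupv (fun j => lab' (v j) x) (fun j => lab (v j) x).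
pose H v := weighted_sum p1 B (fun x => weight p1 r B x * f x v).
have lcup : local d cupv by have := @local_cup_vandermonde F D p1 beta B; rewrite dE.
have ccup : cocycle d cupv by have := @cocycle_cup_vandermonde F D p1 beta B; rewrite dE.
have prism_ext a a' b b' : (forall j, (j <= d')%N -> a j = a' j) ->
    (forall j, (j <= d')%N -> b j = b' j) -> prism d cupv a b = prism d cupv a' b'.
  move=> Ea Eb; apply: eq_bigr => i _; congr (_ * _); apply: lcup => j le_j.
  rewrite /prism_path; case: leqP => ij; first by rewrite Ea //; have := ltn_ord i; lia.
  by rewrite Eb //; lia.
rewrite -[RHS](@kuhn_stokes F d' M H).
- rewrite /weighted_sum -list_sumB.
  transitivity (list_sum (B * p1)%N (fun t => let x := nth 0 (0 :: t) in
    \sum_(u : {ffun 'I_d -> 'I_M}) \sum_(s : 'S_d) \sum_(i < d.+1)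
      (-1) ^+ s * ((-1) ^+ i * (weight p1 r B x * f x (fun j => kuhn_vertex u s (bump i j)))))).
    apply: eq_list_sum => t _ /=; move: (nth 0 _) => x.
    rewrite -mulrBr /label_sum -sumrB big_distrr; apply: eq_bigr => u _ /=.
    rewrite -sumrB big_distrr; apply: eq_bigr => s _ /=.
    rewrite -mulrBr (prism_homotopy _ _ lcup ccup).
    rewrite mulrA big_distrr; apply: eq_bigr => i _ /=.
    by rewrite -mulrA mulrCA; congr (_ * _); rewrite mulrCA.
  rewrite list_sum_bigsum; apply: eq_bigr => u _.
  rewrite list_sum_bigsum; apply: eq_bigr => s _.
  rewrite list_sum_bigsum /coboundary big_distrr; apply: eq_bigr => i _ /=.
  by rewrite !list_sumZ.
- move=> v v' E; apply: eq_list_sum => s _; congr (_ * _).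
  by apply: prism_ext => j le_j; rewrite E.
- move=> v m c c0 vc; rewrite /H.
  have cF : #|F| = (r * p1.+1)%N by rewrite cardF -expnSr prednK.
  (* The index that is inactive on the whole facet. *)
  have [nu nu_le act0] : exists2 nu, (nu <= d)%N & forall j, (j <= d')%N -> ~ active (v j) nu.
    case: c0 => cE; [exists m.+1 | exists (m : nat)] => //; try exact: ltnW.
      by move=> j le_j /(_ m)[_ /(_ erefl)]; rewrite vc // cE.
    by move=> j le_j /(_ m)[/(_ erefl) + _]; rewrite vc // cE eqxx.
  apply: (@weighted_sum_eq0 F p1 r B _ _ cF _ nu).
  + by rewrite -ltnS prime_gt1.
  + by rewrite expn_gt0.
  + by move: dE; case: B.
  + by rewrite dE.
  + move=> x x' E; apply: prism_ext => j _; [apply: ext'|apply: ext] => i le_i _; apply: E; by rewrite dE.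
  + move=> x e; rewrite /f /prism; apply: eq_bigr => i _; congr (_ * _).
    rewrite -[RHS](cup_vandermonde_shift _ _ _ _ (fun e' => trace (alpha e' * e))).
    apply: lcup => j le_j; apply: funext => e'; rewrite /prism_path.
    by case: leqP => _; rewrite ?sh ?sh'.
  + move=> x a; apply: prism_ext => j le_j; [apply: ext'|apply: ext] => i le_i act;
      rewrite /update; case: eqP => // E; by case: (act0 j le_j); rewrite -E.
Qed.

(** Otherwise the sum of the labels would vanish, whereas its value for the canonical
    labels does not. *)
Lemma exists_full_simplex (lab : ('I_d -> nat) -> (nat -> F) -> D -> F) :
  equivariant_label lab ->
  exists (u : {ffun 'I_d -> 'I_M}) (s : 'S_d) (x : nat -> F),
    cupv (fun j => lab (kuhn_vertex u s j) x) != 0.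
Proof.
move=> elab; apply: contrapT => H.
have cup0 (u : {ffun 'I_d -> 'I_M}) s x : cupv (fun j => lab (kuhn_vertex u s j) x) = 0.
  by apply/eqP; apply: contrapT => /negP nz; apply: H; exists u, s, x.
have := @weighted_sum_cup_neq0 F p1 k p_pr charF k_gt0 cardF B (fun b => alpha (beta b)) (fun b => alpha_neq0 _).
have -> : weighted_sum p1 B (fun x => weight p1 r B x *
     cup_vandermonde p1 (fun b => alpha (beta b)) B (fun j a => trace (a * x j)))
  = weighted_sum p1 B (fun x => weight p1 r B x * label_sum canonical_label x).
  by apply: eq_list_sum => s _; rewrite label_sum_canonical.
rewrite (weighted_label_sum_invariant equivariant_canonical elab) /weighted_sum.
rewrite (eq_list_sum (Psi' := fun=> 0)) ?list_sum0 ?eqxx // => s _.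
by rewrite /label_sum big1 ?mulr0 // => u _; rewrite big1 // => t _; rewrite cup0 mulr0.
Qed.

End Labelling.

(** * Labels from real-valued shares *)

Section PrimeSubfield.
Context {F : finFieldType} (p : nat).
Hypothesis (p_pr : prime p) (charF : p \in [pchar F]).

Lemma natr_inj_lt_char (i j : nat) : (i < p)%N -> (j < p)%N -> i%:R = j%:R :> F -> i = j.
Proof.
wlog le_ij : i j / (i <= j)%N.
  by move=> H ip jp E; case/orP: (leq_total i j) => le; [apply: H|symmetry; apply: H].
move=> ip jp E; apply/eqP; rewrite eqn_leq le_ij /= -subn_eq0.
have /eqP : (j - i)%:R = 0 :> F by rewrite natrB // E subrr.
rewrite -(dvdn_pcharf charF); case: (posnP (j - i)) => // lt0.
by rewrite gtnNdvd // (leq_ltn_trans (leq_subr _ _)).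
Qed.

(** The polynomial X^p - X has no room for a root outside the p natural numbers. *)
Lemma prime_subfieldP (z : F) : z ^+ p = z -> exists c : 'I_p, z = c%:R.
Proof.
move=> zp; apply: contrapT => H.
have p1 := prime_gt1 p_pr.
pose P : {poly F} := 'X^p - 'X.
have sP : size P = p.+1.
  by rewrite size_polyDl size_polyXn // size_polyN size_polyX.
have frobn c : (c%:R : F) ^+ p = c%:R by rewrite -(pFrobenius_autE charF) rmorph_nat.
have := @max_poly_roots _ P (z :: [seq (c%:R : F) | c <- iota 0 p]).
rewrite -size_poly_eq0 sP /= size_map size_iota ltnn => /(_ isT) H1.
suff : false by [].
apply: H1.
  apply/andP; split; first by rewrite rootE !hornerE zp subrr.
  by apply/allP => _ /mapP[c _ ->]; rewrite rootE !hornerE frobn subrr.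
apply/andP; split; last first.
  rewrite map_inj_in_uniq ?iota_uniq // => i j; rewrite !mem_iota !add0n /=.
  exact: natr_inj_lt_char.
apply/negP => /mapP[c]; rewrite mem_iota add0n /= => cp zE.
by apply: H; exists (Ordinal cp).
Qed.

Lemma natr_frob c : (c%:R : F) ^+ p = c%:R.
Proof. by rewrite -(pFrobenius_autE charF) rmorph_nat. Qed.

Lemma vandermonde_full (y : nat -> F) (c : 'I_p) : (forall j, y j ^+ p = y j) ->
  vandermonde p y != 0 -> exists2 j : 'I_p, true & y j = c%:R.
Proof.
move=> yp nz; pose g (j : 'I_p) : 'I_p := projT1 (cid (prime_subfieldP (yp j))).
have gE (j : 'I_p) : y j = (g j)%:R by rewrite /g; case: cid.
have gi : injective g.
  move=> i j E; apply/eqP; apply: contraNT nz => ij; apply/eqP.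
  wlog lt : i j E ij / (i < j)%N.
    move=> H; case: (ltngtP i j) => [||E']; [exact: H | | by rewrite (val_inj E') eqxx in ij].
    by move=> lt; apply: (H j i) => //; rewrite eq_sym.
  by apply: (@vandermonde_repeat _ _ _ i j); rewrite ?lt ?ltn_ord // !gE E.
have [h _ hK] := injF_bij gi.
by exists (h c); rewrite // gE hK.
Qed.

End PrimeSubfield.

Section RealLabels.
Context {F : finFieldType} {R : realFieldType} (p1 k M d' n A : nat).
Local Notation p := p1.+1.
Local Notation d := d'.+1.
Hypothesis (p_pr : prime p) (charF : p \in [pchar F]) (k_gt0 : (0 < k)%N).
Hypothesis (cardF : #|F| = (p ^ k)%N).
Hypothesis (dE : (n * A * p1)%N = d) (M_gt0 : (0 < M)%N).
Context (alpha : 'I_A -> F).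
Hypothesis alpha_neq0 : forall a, alpha a != 0.
Local Notation trace := (@trace F p k).
Context (f : ('I_d -> nat) -> 'I_n -> nat -> R) (S : 'I_n -> R).
Hypothesis f_active : forall v i nu, ~ active M v nu -> f v i nu = 0.
Hypothesis f_sum : forall v i, \sum_(nu < d.+1) f v i nu = S i.

Definition share (v : 'I_d -> nat) (x : nat -> F) (i : 'I_n) (a : F) (z : F) : R :=
  \sum_(nu < d.+1 | trace (a * x nu) == z) f v i nu.

Definition relative_share v x (e : 'I_n * 'I_A) (c : 'I_p) : R :=
  share v x e.1 (alpha e.2) (trace (alpha e.2 * x (first_zero v)) + c%:R).

(** The maximum is searched relative to the canonical label, so that ties are broken
    in a way that commutes with translations. *)
Definition max_label v x (e : 'I_n * 'I_A) : F :=
  trace (alpha e.2 * x (first_zero v))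
    + ([arg max_(c > ord0) relative_share v x e c]%O : 'I_p)%:R.

Lemma equivariant_max_label :
  equivariant_label p1 k M (fun e => alpha e.2) max_label.
Proof.
have fz_act v := active_first_zero M_gt0 v.
split=> [v x x' E|v x c e]; rewrite /max_label.
  apply: funext => e; rewrite !(E (first_zero v)) ?first_zero_leq //.
  congr (_ + _%:R); congr (nat_of_ord (Order.arg_max _ _ _)).
  apply: funext => c; rewrite /relative_share !(E (first_zero v)) ?first_zero_leq //.
  rewrite /share big_mkcond [RHS]big_mkcond; apply: eq_bigr => nu _.
  have [act|nact] := pselect (active M v nu); last by rewrite f_active // !if_same.
  by rewrite E // -ltnS.
have Tc y : trace (alpha e.2 * (y + c)) = trace (alpha e.2 * y) + trace (alpha e.2 * c).
  by rewrite mulrDr (traceD k p_pr charF).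
rewrite Tc addrAC; congr (_ + _%:R + _); congr (nat_of_ord (Order.arg_max _ _ _)).
apply: funext => c'; rewrite /relative_share /share; apply: eq_bigl => nu.
by rewrite !Tc addrAC (inj_eq (addIr _)).
Qed.

Lemma max_label_frob v x e : max_label v x e ^+ p = max_label v x e.
Proof.
rewrite /max_label -(pFrobenius_autE charF) rmorphD /= rmorph_nat pFrobenius_autE.
by rewrite trace_frob.
Qed.

(** The p shares add up to S, so the largest of them is at least S / p. *)
Lemma max_label_share v x e :
  S e.1 <= p%:R * share v x e.1 (alpha e.2) (max_label v x e).
Proof.
rewrite /max_label; case: arg_maxP => // c _ cmax.
rewrite -/(relative_share v x e c) -(f_sum v).
have -> : \sum_(nu < d.+1) f v e.1 nu = \sum_(c' : 'I_p) relative_share v x e c'.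
  rewrite /relative_share /share (exchange_big_dep predT) //=; apply: eq_bigr => nu _.
  have [c0 c0E] : exists c0 : 'I_p, trace (alpha e.2 * x nu) - trace (alpha e.2 * x (first_zero v)) = c0%:R.
    apply: (prime_subfieldP p_pr charF).
    by rewrite -(pFrobenius_autE charF) rmorphB /= !pFrobenius_autE !trace_frob.
  rewrite (bigD1 c0) /=; last by rewrite -c0E addrC subrK.
  rewrite big1 ?addr0 // => c1 /andP[/eqP E ne].
  case/negP: ne; apply/eqP/val_inj/(natr_inj_lt_char charF (ltn_ord _) (ltn_ord _)).
  by rewrite -c0E E addrAC subrr add0r.
rewrite mulr_natl -[X in _ *+ X]card_ord -sumr_const; apply: ler_sum => c' _.
exact: cmax.
Qed.

Lemma exists_balanced_simplex :
  exists (u : {ffun 'I_d -> 'I_M}) (s : 'S_d) (x : nat -> F),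
    forall i a (c : 'I_p), exists2 j, (j <= d)%N &
      S i <= p%:R * share (kuhn_vertex u s j) x i (alpha a) c%:R.
Proof.
have n0 : (0 < n)%N by move: dE; case: n.
have A0 : (0 < A)%N by move: dE; case: A; rewrite ?muln0.
pose D : finType := ('I_n * 'I_A)%type.
pose e0 : D := (Ordinal n0, Ordinal A0).
pose beta b : D := nth e0 (enum D) b.
have [u [s [x nz]]] := @exists_full_simplex F D p1 k (n * A)%N M d' p_pr charF k_gt0 cardF
  dE M_gt0 beta _ (fun e => alpha_neq0 _) _ equivariant_max_label.
exists u, s, x => i a c.
have cardD : #|D| = (n * A)%N by rewrite card_prod !card_ord.
pose b : 'I_(n * A) := cast_ord cardD (enum_rank ((i, a) : D)).
have bE : beta b = (i, a) by rewrite /beta /= nth_enum_rank.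
have nzb : vandermonde p (fun j => max_label (kuhn_vertex u s (b * p1 + j)) x (i, a)) != 0.
  by apply: contraNneq nz => z0; rewrite /cup_vandermonde (bigD1 b) //= bE z0 mul0r.
have [j _ jE] := @vandermonde_full F p p_pr charF _ c (fun j => max_label_frob _ _ _) nzb.
exists (b * p1 + j)%N.
  rewrite -dE; have := ltn_ord b; have := ltn_ord j; rewrite ltnS => le_j lt_b.
  by rewrite (leq_trans (leq_add (leqnn _) le_j)) // -mulSnr leq_mul2r lt_b orbT.
by have := max_label_share (kuhn_vertex u s (b * p1 + j)) x (i, a); rewrite jE.
Qed.

End RealLabels.

(** * Projections of a function along traces *)

Section Directions.
Context {F : finFieldType} (p k : nat).
Hypothesis (p_pr : prime p) (charF : p \in [pchar F]) (k_gt0 : (0 < k)%N).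
Hypothesis (cardF : #|F| = (p ^ k)%N).
Local Notation trace := (@trace F p k).

(** The fibres of x |-> x^(p-1) on the nonzero elements are the orbits of the
    multiplication by nonzero elements of the prime subfield. *)
Lemma scalar_representatives : exists (A : nat) (alpha : 'I_A -> F),
  [/\ (A * p.-1)%N = #|F|.-1, (forall a, alpha a != 0) &
      forall x : F, x != 0 -> exists a c, [/\ c != 0, c ^+ p = c & x = c * alpha a]].
Proof.
have p1 := prime_gt1 p_pr.
have pE : p = p.-1.+1 by rewrite prednK // ltnW.
have quot (x z : F) : x != 0 -> (x ^+ p.-1 == z ^+ p.-1) -> z != 0 ->
    exists c, [/\ c != 0, c ^+ p = c & z = c * x].
  move=> x0 /eqP xz z0; exists (z / x); rewrite mulf_neq0 ?invr_neq0 // divfK //; split=> //.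
  by rewrite {1}pE exprS exprMn -xz -exprMn divff // expr1n mulr1.
pose D : {set F} := [set~ 0]; pose f (x : F) := x ^+ p.-1.
have Dn0 x : (x \in D) = (x != 0) by rewrite !inE.
pose P := preim_partition f D.
have partP : finset.partition P D by apply: preim_partitionP.
have eqE : {in D & &, equivalence_rel [rel x y | f x == f y]}.
  by move=> x y z _ _ _; split=> //= /eqP ->.
have [/eqP covP trP nP] := and3P partP.
have blockP B x y : B \in P -> x \in B -> (y \in B) = (y != 0) && (f x == f y).
  move=> BP xB; have xD : x \in D by rewrite -covP; apply/finset.bigcupP; exists B.
  case: (boolP (y \in D)) => [yD|]; last first.
    move=> yD; move: (yD); rewrite Dn0 => /negPf ->; apply: contraNF yD => yB.
    by rewrite -covP; apply/finset.bigcupP; exists B.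
  by rewrite -Dn0 yD -(def_pblock trP BP xB) pblock_equivalence_partition.
have block0 B : B \in P -> exists2 x, x \in B & x != 0.
  move=> BP; have /finset.set0Pn[x xB] : B != finset.set0 by apply: contraNneq nP => <-.
  by exists x => //; rewrite -Dn0 -covP; apply/finset.bigcupP; exists B.
have cardP : {in P, forall B : {set F}, #|B| = p.-1}.
  move=> B BP; have [x xB x0] := block0 B BP.
  have -> : B = [set (c : nat).+1%:R * x | c : 'I_p.-1].
    apply/setP => y; rewrite (blockP B x) //; apply/andP/imsetP => [[y0 xy]|[c _ ->]].
      have [c [c0 cp ->]] := quot x y x0 xy y0.
      have [c' c'E] := prime_subfieldP p_pr charF cp.
      move: c0; rewrite c'E; case: c' {c'E} => -[|c'] lt; first by rewrite eqxx.
      by move=> _; have lt' : (c' < p.-1)%N by [rewrite -ltnS -pE]; exists (Ordinal lt').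
    have c0 : (c.+1%:R : F) != 0.
      by rewrite -(dvdn_pcharf charF) gtnNdvd // {2}pE ltnS.
    rewrite mulf_neq0 //; split=> //; rewrite /f exprMn.
    by rewrite (_ : _.+1%:R ^+ _ = 1) ?mul1r //; apply: (mulfI c0); rewrite -exprS -pE natr_frob ?mulr1.
  rewrite card_imset ?card_ord // => c c' /(mulIf x0) E; apply/val_inj/succn_inj.
  by apply: (natr_inj_lt_char charF _ _ E); rewrite {2}pE ltnS.
pose blk (a : 'I_#|P|) : {set F} := enum_val a.
pose rep a : F := odflt 1 [pick x in blk a].
have blkP a : blk a \in P by apply: enum_valP.
have repB a : rep a \in blk a.
  have [x xB x0] := block0 _ (blkP a).
  by rewrite /rep; case: pickP => //= /(_ x); rewrite xB.
exists #|P|, rep; split.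
- by rewrite -(card_uniform_partition cardP partP) cardsC1.
- move=> a; move: (repB a); rewrite (blockP _ _ _ (blkP a) (repB a)).
  by case/andP.
- move=> x x0; have xD : x \in finset.cover P by rewrite covP Dn0.
  have BP := pblock_mem xD; pose a := enum_rank_in BP (finset.pblock P x).
  have aE : blk a = finset.pblock P x by rewrite /blk enum_rankK_in.
  have /andP[r0 rx] : (rep a != 0) && (f x == f (rep a)).
    by rewrite -(blockP (finset.pblock P x)) // ?finset.mem_pblock // -aE.
  by exists a; apply: quot => //; rewrite eq_sym.
Qed.

Lemma trace_neq0 : exists b : F, trace b != 0.
Proof.
have [mT sT] := @trace_poly_monic F p k p_pr k_gt0.
apply: contrapT => H.
have := @max_poly_roots _ (@trace_poly F p k) (enum F) (monic_neq0 mT).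
rewrite sT enum_uniq -cardE cardF ltnS leqNgt ltn_exp2l ?prime_gt1 // prednK // leqnn.
suff -> : all (root (@trace_poly F p k)) (enum F) by move=> /(_ isT isT).
apply/allP => b _; rewrite rootE horner_trace.
by apply: contrapT => nz; apply: H; exists b; apply/negP.
Qed.

Context {R : realFieldType} (y : F -> R) (S : R).
Hypothesis yS : \sum_g y g = S.

(** Sum the hypothesis at z = T (a h) over all nonzero a.  The value y h is counted
    #|F| - 1 times and each other value K times, where K < #|F| - 1 is the number of
    nonzero zeros of the trace; this determines y h from S. *)
Lemma constant_of_projections :
  (forall a z, a != 0 -> z ^+ p = z -> \sum_(g | trace (a * g) == z) y g = S / p%:R) ->
  forall g, y g = S / (#|F|)%:R.
Proof.
move=> H; pose K := #|[pred b | (b != 0) && (trace b == 0)]|.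
have E h : (#|F|.-1 - K)%N%:R * y h = #|F|.-1%:R * (S / p%:R) - K%:R * S.
  have KE g : g != h -> #|[pred a | (a != 0) && (trace (a * g) == trace (a * h))]| = K.
    move=> gh; have gh0 : g - h != 0 by rewrite subr_eq0.
    rewrite /K -(card_imset _ (mulIf gh0)); apply: eq_card => b; rewrite !inE.
    apply/imsetP/andP => [[a]|[b0 Tb]].
      rewrite inE => /andP[a0 /eqP Ta] ->; rewrite mulf_neq0 //; split=> //.
      by rewrite mulrBr (traceB k p_pr charF) Ta subrr.
    exists (b / (g - h)); last by rewrite divfK.
    rewrite inE mulf_neq0 ?invr_neq0 //= -subr_eq0 -(traceB k p_pr charF) -mulrBr divfK //.
  have : \sum_(a : F | a != 0) \sum_(g | trace (a * g) == trace (a * h)) y g = #|F|.-1%:R * (S / p%:R).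
    rewrite (eq_bigr (fun=> S / p%:R)) ?sumr_const ?mulr_natl ?cardC1 // => a a0.
    by rewrite H // trace_frob.
  rewrite (exchange_big_dep predT) //=.
  rewrite (eq_bigr (fun g => (#|[pred a | (a != 0) && (trace (a * g) == trace (a * h))]|)%:R * y g)); last first.
    by move=> g _; rewrite sumr_const mulr_natl.
  rewrite (bigD1 h) //= (eq_bigr (fun g => K%:R * y g)); last by move=> g /KE ->.
  rewrite -big_distrr /= (eq_card (B := predC1 0)) => [|a]; last by rewrite !inE eqxx andbT.
  rewrite cardC1 => <-.
  have -> : S = y h + \sum_(i | i != h) y i by rewrite -yS (bigD1 h).
  rewrite natrB; first by ring.
  rewrite -(cardC1 (0 : F)); apply: subset_leq_card; apply/fintype.subsetP => b; rewrite !inE.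
  by case/andP.
have Kq : (K < #|F|.-1)%N.
  have [b Tb] := trace_neq0; rewrite -(cardC1 (0 : F)); apply: proper_card.
  apply/properP; split; first by apply/fintype.subsetP => c; rewrite !inE => /andP[].
  exists b; rewrite !inE; last by rewrite (negPf Tb) andbF.
  by apply: contraNneq Tb => ->; rewrite (trace0 k p_pr charF).
have yE g h : y g = y h.
  apply: (mulfI (x := (#|F|.-1 - K)%N%:R)); last by rewrite !E.
  by rewrite pnatr_eq0 subn_eq0 -ltnNge.
move=> g; rewrite -yS (eq_bigr (fun=> y g)) => [|h _]; last exact: yE.
rewrite sumr_const -[y g *+ _]mulr_natl mulrAC divff ?mul1r // pnatr_eq0 -lt0n.
by apply: ltnW; exact: finRing_gt1.
Qed.

End Directions.

(** * Passage to the limit *)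

Section Balanced.
Context {F : finFieldType} {R : realFieldType} (p k A N : nat).
Hypothesis (p_pr : prime p) (charF : p \in [pchar F]) (k_gt0 : (0 < k)%N).
Hypothesis (cardF : #|F| = (p ^ k)%N).
Context (alpha : 'I_A -> F).
Hypothesis alphaP : forall x : F, x != 0 -> exists a c, [/\ c != 0, c ^+ p = c & x = c * alpha a].
Local Notation trace := (@trace F p k).

Lemma traceZ c y : c ^+ p = c -> trace (c * y) = c * trace y.
Proof.
move=> cp; rewrite /trace big_distrr; apply: eq_bigr => j _ /=; rewrite exprMn; congr (_ * _).
by elim: (j : nat) => [|i IH]; rewrite ?expn0 ?expr1 // expnSr exprM IH cp.
Qed.

(** The shares add up to S, so the p lower bounds S / p are equalities.  A general
    scalar is an element of the prime subfield times a representative. *)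
Lemma balanced_of_shares (g : 'I_N -> R) (x : 'I_N -> F) S :
  \sum_nu g nu = S ->
  (forall a (c : 'I_p), S <= p%:R * \sum_(nu | trace (alpha a * x nu) == c%:R) g nu) ->
  forall j, \sum_(nu | x nu == j) g nu = S / (#|F|)%:R.
Proof.
move=> gS le; pose y h := \sum_(nu | x nu == h) g nu.
have p0 : (p%:R : R) != 0 by rewrite pnatr_eq0 -lt0n prime_gt0.
have yS : \sum_h y h = S.
  rewrite /y (exchange_big_dep predT) //= -gS; apply: eq_bigr => nu _.
  by rewrite (big_pred1 (x nu)).
have yT (P : pred F) : \sum_(h | P h) y h = \sum_(nu | P (x nu)) g nu.
  rewrite /y (exchange_big_dep (fun nu => P (x nu))) /=; last by move=> h nu Ph /eqP ->.
  apply: eq_bigr => nu Px; rewrite (big_pred1 (x nu)) // => h /=.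
  by rewrite [x nu == h]eq_sym; case: (eqVneq h (x nu)) => [->|ne]; rewrite ?Px ?andbF.
have E a (c : 'I_p) : \sum_(nu | trace (alpha a * x nu) == c%:R) g nu = S / p%:R.
  pose P (c : 'I_p) := \sum_(nu | trace (alpha a * x nu) == c%:R) g nu.
  have PS : \sum_c P c = S.
    rewrite /P (exchange_big_dep predT) //= -gS; apply: eq_bigr => nu _.
    have [c0 c0E] := prime_subfieldP p_pr charF (trace_frob charF k_gt0 cardF (alpha a * x nu)).
    rewrite (big_pred1 c0) // => c1 /=; rewrite c0E; apply/eqP/eqP => [|->//].
    by move=> /(natr_inj_lt_char charF (ltn_ord _) (ltn_ord _)) /val_inj.
  have lec c' : S / p%:R <= P c'.
    by rewrite ler_pdivrMr ?ltr0n ?prime_gt0 // mulrC le.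
  apply/eqP; rewrite eq_le lec andbT -/(P c).
  have : \sum_(c' | c' != c) S / p%:R <= \sum_(c' | c' != c) P c' by apply: ler_sum.
  move: PS; rewrite (bigD1 c) //= => PS.
  have : \sum_(c' : 'I_p) S / p%:R = S.
    by rewrite sumr_const card_ord -[_ *+ p]mulr_natl mulrCA divff ?mulr1.
  rewrite (bigD1 c) //= => S2; lra.
move=> j; rewrite -/(y j); apply: (constant_of_projections p_pr charF k_gt0 cardF yS) => b z b0 zp.
rewrite (yT (fun h => trace (b * h) == z)).
have [a [c [c0 cp ->]]] := alphaP b0.
have [c' c'E] : exists c' : 'I_p, z / c = c'%:R.
  by apply: (prime_subfieldP p_pr charF); rewrite expr_div_n zp cp.
rewrite -(E a c'); apply: eq_bigl => nu /=; rewrite -mulrA (traceZ _ cp) -c'E.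
by rewrite -(inj_eq (mulIf c0) _ (z / c)) divfK // mulrC.
Qed.

End Balanced.

Local Open Scope classical_set_scope.
Local Open Scope ring_scope.

Section Limit.
Context {F : finFieldType} {R : realType} (p1 k d' n A : nat).
Local Notation p := p1.+1.
Local Notation d := d'.+1.
Hypothesis (p_pr : prime p) (charF : p \in [pchar F]) (k_gt0 : (0 < k)%N).
Hypothesis (cardF : #|F| = (p ^ k)%N).
Context (alpha : 'I_A -> F).
Hypothesis alpha_neq0 : forall a, alpha a != 0.
Hypothesis alphaP : forall x : F, x != 0 -> exists a c, [/\ c != 0, c ^+ p = c & x = c * alpha a].
Hypothesis (dE : (n * A * p1)%N = d).
Local Notation trace := (@trace F p k).
Context (G : 'rV[R]_d -> 'I_n -> 'I_d.+1 -> R) (S : 'I_n -> R).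
Hypothesis G_face : forall (x : 'rV[R]_d) i (m : 'I_d) (nu : 'I_d.+1), (forall j, 0 <= x ord0 j) ->
  (x ord0 m = 1 /\ nu = m :> nat) \/ (x ord0 m = 0 /\ nu = m.+1 :> nat) -> G x i nu = 0.
Hypothesis G_sum : forall x i, \sum_nu G x i nu = S i.
Hypothesis G_usc : forall (x : 'rV[R]_d) i nu e, 0 < e -> \forall x' \near x, G x' i nu < G x i nu + e.

Definition grid_point M (v : 'I_d -> nat) : 'rV[R]_d := \row_m ((v m)%:R / M%:R).

Lemma approx_equipartition M : (0 < M)%N ->
  exists (u : {ffun 'I_d -> 'I_M}) (s : 'S_d) (x : {ffun 'I_d.+1 -> F}),
    forall i a (c : 'I_p), exists2 j, (j <= d)%N &
      S i <= p%:R * \sum_(nu | trace (alpha a * x nu) == c%:R)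
                      G (grid_point M (kuhn_vertex u s j)) i nu.
Proof.
move=> M0; have MR0 : (M%:R : R) != 0 by rewrite pnatr_eq0 -lt0n.
pose f (v : 'I_d -> nat) (i : 'I_n) (nu : nat) : R := G (grid_point M v) i (inord nu).
have fa v i nu : ~ active M v nu -> f v i nu = 0.
  move=> /existsNP[m /not_andP[]] /not_implyP[E] => [/negP|/negP]; rewrite negbK => /eqP vm.
    apply: (@G_face _ _ m); first by move=> j; rewrite mxE divr_ge0 ?ler0n.
    by left; rewrite mxE vm divff // inordK // -E ltnW // ltnS.
  apply: (@G_face _ _ m); first by move=> j; rewrite mxE divr_ge0 ?ler0n.
  by right; rewrite mxE vm mul0r inordK // -E ltnS.
have fs v i : \sum_(nu < d.+1) f v i nu = S i.
  by rewrite -(G_sum (grid_point M v) i); apply: eq_bigr => nu _; rewrite /f inord_val.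
have [u [s [x H]]] := exists_balanced_simplex p_pr charF k_gt0 cardF dE M0 alpha_neq0 fa fs.
exists u, s, [ffun nu : 'I_d.+1 => x nu] => i a c.
have [j jd le] := H i a c; exists j => //.
apply: (le_trans le); rewrite le_eqVlt; apply/orP; left; apply/eqP; congr (_ * _).
by apply: eq_big => nu; rewrite ?ffunE // /f inord_val.
Qed.

(** Take a cluster point of the approximate solutions.  If no colouring were balanced
    at this point, then for each colouring some share would be strictly below S / p
    there, hence near it by upper semicontinuity, and a small full simplex close to
    the cluster point would contradict this. *)
Lemma exists_equipartition : exists (x : 'rV[R]_d) (theta : 'I_d.+1 -> F),
  forall i j, \sum_(nu | theta nu == j) G x i nu = S i / (#|F|)%:R.
Proof.
have approx : forall N : nat, exists usx : {ffun 'I_d -> 'I_N.+1} * 'S_d * {ffun 'I_d.+1 -> F},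
   forall i a (c : 'I_p), exists2 j, (j <= d)%N &
      S i <= p%:R * \sum_(nu | trace (alpha a * usx.2 nu) == c%:R)
                      G (grid_point N.+1 (kuhn_vertex usx.1.1 usx.1.2 j)) i nu.
  move=> N; have [u [s [x H]]] := @approx_equipartition N.+1 isT.
  by exists (u, s, x).
pose h N := projT1 (cid (approx N)); have hP N := projT2 (cid (approx N)).
pose y N : 'rV[R]_d := grid_point N.+1 (kuhn_vertex (h N).1.1 (h N).1.2 0).
pose cube := [set v : 'rV[R]_d | forall i, `[0, 1]%classic (v ord0 i)].
have cube_compact : compact cube.
  by apply: (@rV_compact R d (fun=> `[0, 1]%classic)) => i; exact: segment_compact.
have y_cube N : cube (y N).
  move=> i; rewrite /= in_itv /= mxE divr_ge0 ?ler0n //= ler_pdivrMr ?ltr0n //.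
  by rewrite mul1r ler_nat /kuhn_vertex addn0 ltnW.
have [] := cube_compact (y @ \oo) _; first by exists 0%N => // N _; exact: y_cube.
move=> x [_ clx]; exists x; apply: contrapT => H.
have Hth (th : {ffun 'I_d.+1 -> F}) : exists iac : 'I_n * 'I_A * 'I_p,
    p%:R * \sum_(nu | trace (alpha iac.1.2 * th nu) == iac.2%:R) G x iac.1.1 nu < S iac.1.1.
  apply: contrapT => Hth; apply: H; exists th => i j.
  apply: (balanced_of_shares p_pr charF k_gt0 cardF alphaP (G_sum x i)) => a c.
  by rewrite leNgt; apply/negP => lt; apply: Hth; exists (i, a, c).
have [iac iacP] := choice Hth.
pose Q (th : {ffun 'I_d.+1 -> F}) (x' : 'rV[R]_d) : Prop :=
  p%:R * \sum_(nu | trace (alpha (iac th).1.2 * th nu) == (iac th).2%:R) G x' (iac th).1.1 nu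
      < S (iac th).1.1.
have near_x : \forall x' \near x, forall th, Q th x'.
  apply: (@filter_forall _ _ Q (nbhs x)) => th; rewrite /Q.
  move: (iac th) (iacP th) => -[[i a] c] /= lt.
  pose s := \sum_(nu | trace (alpha a * th nu) == c%:R) G x i nu.
  pose e := (S i - p%:R * s) / (p%:R * d.+1%:R) / 2.
  have pd0 : 0 < (p%:R * d.+1%:R : R) by rewrite mulr_gt0 ?ltr0n.
  have e0 : 0 < e by rewrite !divr_gt0 // subr_gt0.
  have Hn : \forall x' \near x, forall nu, G x' i nu < G x i nu + e.
    by apply: (@filter_forall _ _ (fun nu x' => G x' i nu < G x i nu + e) (nbhs x)) => nu; exact: G_usc.
  apply: (filterS _ Hn) => x' lt'.
  have le1 : \sum_(nu | trace (alpha a * th nu) == c%:R) G x' i nu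
      <= s + \sum_(nu | trace (alpha a * th nu) == c%:R) e.
    by rewrite -big_split /=; apply: ler_sum => nu _; exact: ltW.
  have le2 : \sum_(nu | trace (alpha a * th nu) == c%:R) e <= d.+1%:R * e.
    rewrite mulr_natl -[X in _ <= _ *+ X]card_ord -sumr_const big_mkcond /=.
    by apply: ler_sum => nu _; case: ifP => // _; exact: ltW.
  have pe : p%:R * (d.+1%:R * e) = (S i - p%:R * s) / 2.
    by rewrite mulrA /e mulrA [X in X / 2]mulrC divfK // gt_eqF.
  have le3 : p%:R * \sum_(nu | trace (alpha a * th nu) == c%:R) G x' i nu
     <= p%:R * s + p%:R * (d.+1%:R * e).
    by rewrite -mulrDr ler_wpM2l ?ler0n // (le_trans le1) // lerD2l.
  by apply: (le_lt_trans le3); rewrite pe -/s in lt *; move: lt; lra.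
have [e /= e0 ball_e] := (nbhs_ballP _ _).1 near_x.
have [N0 N0e] : exists N0 : nat, N0.+1%:R^-1 < e / 2.
  have := near_infty_natSinv_lt (PosNum (divr_gt0 e0 (ltr0n _ 2))).
  by move=> [N0 _ HN]; exists N0; apply: HN => /=.
have [] := clx [set y N | N in [set N | (N0 <= N)%N]] (ball x (e / 2)).
- by exists N0 => // N /= le_N; exists N.
- by apply: nbhsx_ballx; rewrite divr_gt0.
move=> _ [[N /= le_N <-] byN].
set th := (h N).2; have [j jd] := hP N (iac th).1.1 (iac th).1.2 (iac th).2.
rewrite leNgt => /negP; apply; apply: ball_e.
rewrite (_ : e = e / 2 + e / 2); last by rewrite -splitr.
apply: ball_triangle byN _; split=> [|i m]; first by rewrite divr_gt0.
rewrite /ball /= /ball_ !mxE -mulrBl normrM [X in _ * X]ger0_norm ?invr_ge0 ?ler0n //.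
have le1 : `|((kuhn_vertex (h N).1.1 (h N).1.2 0 m)%:R : R) - (kuhn_vertex (h N).1.1 (h N).1.2 j m)%:R| <= 1.
  rewrite /kuhn_vertex addn0 natrD opprD addrA subrr add0r normrN.
  by case: (_ < _)%N; rewrite ?normr0 ?normr1.
apply: le_lt_trans (ler_wpM2r _ le1) _; first by rewrite invr_ge0 ler0n.
rewrite mul1r; apply: le_lt_trans N0e.
by rewrite lef_pV2 ?posrE ?ltr0n // ler_nat ltnS.
Qed.

End Limit.

(** * The face fan in barycentric coordinates *)

Section ConvexCombinations.
Context {R : realType} {V : lmodType R}.

Lemma convex_set_comb (A : set V) (x y : V) (t : R) :
  @convex_set R V A -> A x -> A y -> 0 <= t -> t <= 1 -> A (t *: x + (1 - t) *: y).
Proof.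
move=> cA Ax Ay t0 t1.
by have := cA x y (Itv01 t0 t1) (mem_set Ax) (mem_set Ay); rewrite inE.
Qed.

(** The first point is averaged with the normalised average of the others. *)
Lemma convex_set_sum (A : set V) (I : eqType) (s : seq I) (w : I -> R) (b : I -> V) :
  @convex_set R V A -> (forall i, i \in s -> 0 <= w i) -> (forall i, i \in s -> w i != 0 -> A (b i)) ->
  0 < \sum_(i <- s) w i ->
  A ((\sum_(i <- s) w i)^-1 *: \sum_(i <- s) w i *: b i).
Proof.
move=> cA; elim: s => [|i s IH] w0 Ab; first by rewrite big_nil ltxx.
rewrite !big_cons => W0.
have w0' j : j \in s -> 0 <= w j by move=> js; apply: w0; rewrite inE js orbT.
have Ab' j : j \in s -> w j != 0 -> A (b j) by move=> js; apply: Ab; rewrite inE js orbT.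
have wi0 : 0 <= w i by apply: w0; rewrite inE eqxx.
have [wi|wi] := eqVneq (w i) 0.
  by move: W0; rewrite wi scale0r !add0r; exact: IH.
have Abi : A (b i) by apply: Ab => //; rewrite inE eqxx.
have Wn : \sum_(j <- s) w j >= 0 by rewrite big_seq; apply: sumr_ge0 => j; exact: w0'.
have [Ws|Ws] := eqVneq (\sum_(j <- s) w j) 0.
  have -> : \sum_(j <- s) w j *: b j = 0.
    rewrite big_seq big1 // => j js; suff -> : w j = 0 by rewrite scale0r.
    apply/eqP; move/eqP: Ws; rewrite big_seq psumr_eq0 => [/allP H|l]; last exact: w0'.
    by have := H j js; rewrite js.
  by rewrite Ws !addr0 scalerA mulVf // scale1r.
have Ws0 : 0 < \sum_(j <- s) w j by rewrite lt_neqAle eq_sym Ws.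
have := convex_set_comb cA Abi (IH w0' Ab' Ws0) (t := w i / (w i + \sum_(j <- s) w j)).
rewrite divr_ge0 ?(ltW W0) // ler_pdivrMr // mul1r lerDl Wn => /(_ isT isT).
congr A; rewrite scalerDr !scalerA; congr (_ *: _ + _ *: _); first by rewrite mulrC.
by field; rewrite Ws gt_eqF.
Qed.

End ConvexCombinations.

Section Simplex.
Context {R : realType} {d : nat} (a : 'I_d.+1 -> 'rV[R]_d).
Hypothesis a_indep : affinely_independent a.
Hypothesis a_bary : barycenter a = 0.

Lemma vertex_sum0 : \sum_j a j = 0.
Proof.
move/eqP: a_bary; rewrite /barycenter scaler_eq0 invr_eq0 pnatr_eq0 card_ord /=.
by move/eqP.
Qed.

(** Affine independence of the vertices is the invertibility of this matrix. *)
Definition affine_mx : 'M[R]_(d.+1, 1 + d) :=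
  \matrix_(j < d.+1) (row_mx (const_mx 1) (a j)).

Lemma mul_affine_mx (c : 'rV[R]_d.+1) :
  c *m affine_mx = row_mx ((\sum_j c ord0 j)%:M : 'M[R]_1) (\sum_j c ord0 j *: a j).
Proof.
rewrite mulmx_sum_row; under eq_bigr do rewrite rowK scale_row_mx.
rewrite -[LHS]hsubmxK; congr row_mx.
  apply/rowP => i; rewrite ord1 !mxE summxE /=.
  by apply: eq_bigr => j _; rewrite row_mxEl !mxE mulr1.
apply/rowP => i; rewrite !mxE !summxE /=.
by apply: eq_bigr => j _; rewrite row_mxEr.
Qed.

Lemma affine_mx_unit : affine_mx \in unitmx.
Proof.
rewrite -row_free_unit; apply: inj_row_free => c.
rewrite mul_affine_mx => H.
have := congr1 (fun m : 'M[R]_(1, 1 + d) => lsubmx m) H; rewrite /= row_mxKl linear0 => c1.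
have := congr1 (fun m : 'M[R]_(1, 1 + d) => rsubmx m) H; rewrite /= row_mxKr linear0 => c2.
apply/rowP => j; rewrite mxE; apply: a_indep c2 j.
by move/matrixP/(_ ord0 ord0): c1; rewrite !mxE eqxx mulr1n.
Qed.

(** The coordinates of y on the vertices, normalised to have sum zero; they are unique
    because the barycenter is the origin. *)
Definition bary_coord (j : 'I_d.+1) (y : 'rV[R]_d) : R :=
  (row_mx (0 : 'M[R]_1) y *m invmx affine_mx) ord0 j.

Definition bary_form (j : 'I_d.+1) : 'rV[R]_d := \row_i (invmx affine_mx) (rshift 1 i) j.

Lemma bary_coordE j y : bary_coord j y = \sum_(i < d) bary_form j ord0 i * y ord0 i.
Proof.
rewrite /bary_coord mxE big_split_ord /= big_ord1 row_mxEl mxE mul0r add0r.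
by apply: eq_bigr => i _; rewrite row_mxEr mxE mulrC.
Qed.

Lemma bary_coord_unique (c : 'I_d.+1 -> R) y :
  \sum_j c j = 0 -> \sum_j c j *: a j = y -> forall j, bary_coord j y = c j.
Proof.
move=> c0 cy j; have : (\row_j c j) *m affine_mx = row_mx 0 y.
  rewrite mul_affine_mx; congr row_mx.
    by under eq_bigr do rewrite mxE; rewrite c0; apply/matrixP => u v; rewrite !mxE mul0rn.
  by under eq_bigr do rewrite mxE.
by rewrite /bary_coord => <-; rewrite mulmxK ?affine_mx_unit // mxE.
Qed.

Lemma bary_coordP y : \sum_j bary_coord j y = 0 /\ \sum_j bary_coord j y *: a j = y.
Proof.
have := mul_affine_mx (row_mx (0 : 'M[R]_1) y *m invmx affine_mx).
rewrite mulmxKV ?affine_mx_unit // => /eq_row_mx [c1 c2]; split; last by rewrite [RHS]c2.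
by move/matrixP/(_ ord0 ord0): c1; rewrite !mxE eqxx mulr1n => <-.
Qed.

Lemma bary_coordD j x y : bary_coord j (x + y) = bary_coord j x + bary_coord j y.
Proof. by rewrite !bary_coordE -big_split; apply: eq_bigr => i _; rewrite [(x + y) _ _]mxE mulrDr. Qed.

Lemma bary_coordZ j t y : bary_coord j (t *: y) = t * bary_coord j y.
Proof. by rewrite !bary_coordE big_distrr; apply: eq_bigr => i _; rewrite [(t *: y) _ _]mxE /= mulrCA. Qed.

Lemma bary_coord_vertex i j : bary_coord j (a i) = (i == j)%:R - d.+1%:R^-1.
Proof.
apply: (@bary_coord_unique (fun j => (i == j)%:R - d.+1%:R^-1)).
  rewrite sumrB sumr_const card_ord -[_ *+ d.+1]mulr_natl divff ?pnatr_eq0 //.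
  by rewrite (bigD1 i) //= eqxx big1 ?addr0 ?subrr // => l; rewrite eq_sym => /negPf ->.
under eq_bigr do rewrite scalerBl.
rewrite sumrB -scaler_sumr vertex_sum0 scaler0 subr0.
rewrite (bigD1 i) //= eqxx scale1r big1 ?addr0 // => l; rewrite eq_sym => /negPf ->.
by rewrite scale0r.
Qed.

Definition coord_diff (nu j : 'I_d.+1) (y : 'rV[R]_d) := bary_coord nu y - bary_coord j y.

Lemma coord_diffE nu j y :
  coord_diff nu j y = \sum_(i < d) (bary_form nu - bary_form j) ord0 i * y ord0 i.
Proof.
rewrite /coord_diff !bary_coordE -sumrB; apply: eq_bigr => i _.
by rewrite [(bary_form nu - bary_form j) _ _]mxE [(- bary_form j) _ _]mxE mulrBl.
Qed.

Lemma coord_diff_neq0 nu j : nu != j -> bary_form nu - bary_form j != 0.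
Proof.
move=> nj; apply/eqP => E; have := coord_diffE nu j (a nu).
rewrite E big1 => [|i _]; last by rewrite mxE mul0r.
rewrite /coord_diff !bary_coord_vertex eqxx (negPf nj) add0r opprK subrK => /eqP.
by rewrite oner_eq0.
Qed.

(** Subtracting the smallest coordinate from all of them does not change the vector,
    and leaves nonnegative coefficients on the vertices of the facet. *)
Lemma cone_facetE nu : (0 < d)%N ->
  cone (facet a nu) = [set y | forall j, bary_coord nu y <= bary_coord j y].
Proof.
move=> d0; apply/seteqP; split=> [_ [t /= t0 [y fy <-]] j|y /= H].
  have Hy : facet a nu `<=` [set y | forall j, bary_coord nu y <= bary_coord j y].
    apply: smallest_sub => [x z l|_ [i /= inu <-] l].
      rewrite !inE => Hx Hz l'; rewrite /conv /= !bary_coordD !bary_coordZ lerD //.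
        by rewrite ler_wpM2l.
      by rewrite ler_wpM2l // subr_ge0.
    by rewrite !bary_coord_vertex (negPf inu) lerD2r ler0n.
  by rewrite !bary_coordZ ler_wpM2l //; exact: Hy.
pose g j := bary_coord j y - bary_coord nu y.
have g0 j : 0 <= g j by rewrite subr_ge0.
have gy : \sum_j g j *: a j = y.
  under eq_bigr do rewrite scalerBl.
  by rewrite sumrB -scaler_sumr vertex_sum0 scaler0 subr0; case: (bary_coordP y).
have facet_vertex j : j != nu -> facet a nu (a j).
  by move=> jnu C [_ aC]; apply: aC; exists j.
have [G0|Gn] := eqVneq (\sum_j g j) 0.
  have y0 : y = 0.
    rewrite -gy big1 // => j _; have /eqP := G0; rewrite psumr_eq0 // => /allP /(_ j).
    by rewrite mem_index_enum => /(_ isT) /= /eqP ->; rewrite scale0r.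
  have [j jnu] : exists j : 'I_d.+1, j != nu.
    exists (if nu == ord0 then ord_max else ord0); case: (eqVneq nu ord0) => [->|]; last by rewrite eq_sym.
    by rewrite -val_eqE /= -lt0n.
  by exists 0 => //=; exists (a j); [exact: facet_vertex | rewrite scale0r y0].
have Gp : 0 < \sum_j g j by rewrite lt_neqAle eq_sym Gn sumr_ge0.
exists (\sum_j g j); first exact: ltW.
exists ((\sum_j g j)^-1 *: y); last by rewrite scalerA divff ?scale1r // gt_eqF.
rewrite -{1}gy => C [cC aC]; apply: convex_set_sum => // j _ gj; apply: aC; exists j => //=.
by apply: contraNneq gj => ->; rewrite /g subrr.
Qed.

Lemma translated_coneE nu x : (0 < d)%N ->
  translate x (cone (facet a nu))
    = [set y | forall j, coord_diff nu j y <= coord_diff nu j x].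
Proof.
move=> d0; rewrite cone_facetE //; apply/seteqP; split=> [_ [y /= H <-] j|y /= H].
  by rewrite /coord_diff !bary_coordD; have := H j; lra.
exists (y - x); last by rewrite addrC subrK.
by move=> /= j; rewrite !bary_coordD -scaleN1r !bary_coordZ; have := H j; rewrite /coord_diff; lra.
Qed.

End Simplex.

(** * Borel measures of polyhedra *)

Section BorelMeasures.
Context {R : realType} {d : nat}.
Local Notation V := 'rV[R]_d.
Local Notation borel := (borelRd R d).

Lemma open_borel (U : set V) : open U -> measurable (U : set borel).
Proof. by move=> oU; apply: sub_sigma_algebra. Qed.

Lemma closed_borel (C : set V) : closed C -> measurable (C : set borel).
Proof.
move=> cC; rewrite -[C]setCK; apply: measurableC; apply: open_borel.
exact: closed_openC.
Qed.

Context (mu : {finite_measure set borel -> \bar R}).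

Lemma null_bigsetU (I : Type) (s : seq I) (f : I -> set borel) :
  (forall i, measurable (f i)) -> (forall i, mu (f i) = 0%E) ->
  mu (\big[setU/set0]_(i <- s) f i) = 0%E.
Proof.
move=> mf f0; elim: s => [|i s IH]; first by rewrite big_nil measure0.
by rewrite big_cons; apply: null_set_setU (mf i) _ (f0 i) IH; apply: bigsetU_measurable.
Qed.

Lemma null_subset (A B : set borel) : measurable A -> measurable B ->
  A `<=` B -> mu B = 0%E -> mu A = 0%E.
Proof.
move=> mA mB AB B0; apply/eqP; rewrite eq_le measure_ge0 andbT -B0.
by apply: le_measure; rewrite ?inE.
Qed.

(** A compact part of C is covered by finitely many null open sets. *)
Lemma measure_off_support (C : set V) :
  closed C -> C `&` measure_support mu = set0 -> mu C = 0%E.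
Proof.
move=> cC CS.
have nullnbhs y : exists W : set V, [/\ open W, mu W = 0%E & C y -> W y].
  have [Cy|nCy] := pselect (C y); last first.
    by exists set0; split.
  have : ~ measure_support mu y.
    by move=> Sy; have : (C `&` measure_support mu) y by []; rewrite CS.
  move=> /existsNP[W /not_implyP[oW /not_implyP[Wy /negP]]].
  by rewrite -leNgt measure_le0 => /eqP W0; exists W.
have [U UP] := choice nullnbhs.
pose box (N : nat) := [set y : V | forall i, `[- N%:R, N%:R]%classic (y ord0 i)].
pose K N := box N `&` C.
have compactK N : compact (K N).
  apply: compact_closedI cC; apply: (@rV_compact R d (fun=> `[- N%:R, N%:R]%classic)) => i.
  exact: segment_compact.
have mK N : measurable (K N : set borel).
  apply: closed_borel; apply: closedI cC.
  rewrite (_ : box N = \bigcap_(i in setT) ((fun y : V => y ord0 i) @^-1` `[- N%:R, N%:R]%classic)).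
    apply: closed_bigI => i _; apply: preimage_closed; last exact: itv_closed.
    by move=> y _; exact: coord_continuous.
  by apply/seteqP; split => [y H i _|y H i]; exact: H.
have K0 N : mu (K N) = 0%E.
  have := compactK N; rewrite compact_cover => /(_ _ (K N) U) [].
  - by move=> y _; case: (UP y).
  - by move=> y Ky; exists y => //; have [_ _] := UP y; apply; exact: Ky.2.
  move=> D DK KD; apply: (null_subset (mK N) _ KD).
    by rewrite /cover bigcup_fset; apply: bigsetU_measurable => y _; apply: open_borel; case: (UP y).
  rewrite /cover bigcup_fset; apply: null_bigsetU => y; case: (UP y) => // oU _ _.
  exact: open_borel.
have CK : C = \bigcup_N (K N).
  apply/seteqP; split=> [y Cy|y [N _ []]//].
  exists (Num.bound (\sum_i `|y ord0 i|)) => //; split => // i.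
  rewrite /= in_itv /= -ler_norml; apply: ltW.
  apply: le_lt_trans (archi_boundP _); last by apply: sumr_ge0 => j _.
  by rewrite (bigD1 i) //= lerDl; apply: sumr_ge0.
apply: measure_negligible; first exact: closed_borel.
rewrite CK; apply: negligible_bigcup => N; apply/negligibleP; first exact: mK.
exact: K0.
Qed.

Lemma continuous_linear_form (u : V) : continuous (fun y : V => \sum_(i < d) u ord0 i * y ord0 i).
Proof.
suff H s : continuous (fun y : V => \sum_(i <- s) u ord0 i * y ord0 i) by exact: H.
elim: s => [|i s IH].
  rewrite (_ : (fun y => _) = fun=> 0); first exact: cst_continuous.
  by apply: funext => y; rewrite big_nil.
rewrite (_ : (fun y => _) = fun y : V => u ord0 i * y ord0 i + \sum_(i <- s) u ord0 i * y ord0 i).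
  by move=> x; apply: cvgD (IH x); apply: cvgMr; exact: coord_continuous.
by apply: funext => y; rewrite big_cons.
Qed.

Context {I : finType} (l : I -> V).
Let form j (y : V) : R := \sum_(i < d) l j ord0 i * y ord0 i.

Definition polyhedron (b : I -> R) : set V := [set y | forall j, form j y <= b j].

Lemma closed_polyhedron b : closed (polyhedron b).
Proof.
rewrite (_ : polyhedron b = \bigcap_(j in setT) (form j @^-1` [set z | z <= b j])).
  apply: closed_bigI => j _; apply: preimage_closed; last exact: closed_le.
  by move=> y _; exact: continuous_linear_form.
by apply/seteqP; split => [y H j _|y H j]; exact: H.
Qed.

(** The polyhedra with right-hand sides b + 1/(N+1) decrease to the one of b. *)
Lemma polyhedron_usc b (e : R) : 0 < e -> exists2 h : R, 0 < h &
  forall b', (forall j, b' j <= b j + h) ->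
    fine (mu (polyhedron b')) < fine (mu (polyhedron b)) + e.
Proof.
move=> e0; pose P (N : nat) := polyhedron (fun j => b j + N.+1%:R^-1).
have mP b0 : measurable (polyhedron b0 : set borel) by apply: closed_borel; exact: closed_polyhedron.
have capP : \bigcap_N P N = polyhedron b.
  apply/seteqP; split=> [y H j|y H N _ j]; last first.
    by rewrite (le_trans (H j)) // lerDl invr_ge0 ler0n.
  apply/ler_addgt0Pr => h h0.
  have [N _ HN] := near_infty_natSinv_lt (PosNum h0).
  by rewrite (le_trans (H N Logic.I j)) // lerD2l ltW //; exact: (HN N (leqnn N)).
have cvP : mu \o P @ \oo --> mu (polyhedron b).
  rewrite -capP; apply: nonincreasing_cvg_mu => //.
  - by rewrite -ge0_fin_numE ?measure_ge0 //; apply: fin_num_measure; exact: mP.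
  - by move=> N; exact: mP.
  - by rewrite capP; exact: mP.
  - move=> N M NM; apply/subsetPset => y H j; rewrite (le_trans (H j)) // lerD2l.
    by rewrite lef_pV2 ?posrE ?ltr0n // ler_nat ltnS.
have fineP b0 : (fine (mu (polyhedron b0)))%:E = mu (polyhedron b0) by rewrite fineK // fin_num_measure.
have : (fine \o (mu \o P)) @ \oo --> fine (mu (polyhedron b)).
  by apply: fine_cvg; rewrite fineP.
move=> /cvgr_lt /(_ (fine (mu (polyhedron b)) + e)); rewrite ltrDl => /(_ e0) [N _ HN].
exists N.+1%:R^-1 => [|b' b'b]; first by rewrite invr_gt0 ltr0n.
apply: le_lt_trans (HN N (leqnn N)); rewrite /= -lee_fin !fineP.
apply: le_measure; rewrite ?inE //.
by move=> y H j; rewrite (le_trans (H j)).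
Qed.

End BorelMeasures.

(** * The moving fan and the equipartition *)

Section FanMeasure.
Context {R : realType} {d : nat} (a : 'I_d.+1 -> 'rV[R]_d).
Hypothesis a_indep : affinely_independent a.
Hypothesis a_bary : barycenter a = 0.
Hypothesis d_gt0 : (0 < d)%N.
Local Notation borel := (borelRd R d).
Context (mu : {finite_measure set borel -> \bar R}).

(** Removing from each cell the previous ones changes it by a null set. *)
Lemma measure_almost_partition (N : nat) (C : 'I_N.+1 -> set borel) :
  (forall i, measurable (C i)) -> (forall i j, i != j -> mu (C i `&` C j) = 0%E) ->
  (forall y, exists i, C i y) -> (\sum_i mu (C i) = mu setT)%E.
Proof.
move=> mC C0 Cc; pose F n := C (inord n).
have mF n : measurable (F n) by exact: mC.
have FE (i : 'I_N.+1) : F i = C i by rewrite /F inord_val.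
have mU n : measurable (\big[setU/set0]_(k < n) F k) by apply: bigsetU_measurable.
have null n : (n < N.+1)%N -> mu (F n `&` \big[setU/set0]_(k < n) F k) = 0%E.
  move=> ltn; apply: (@null_subset _ _ mu _ (\big[setU/set0]_(k < n) (F k `&` F n))).
  - exact: measurableI.
  - by apply: bigsetU_measurable => k _; exact: measurableI.
  - by rewrite -big_distrl /= setIC.
  apply: null_bigsetU => k; first exact: measurableI.
  apply: C0; rewrite -val_eqE /= !inordK // ?(ltn_trans (ltn_ord k)) //.
  by rewrite ltn_eqF.
have -> : [set: borel] = \big[setU/set0]_(k < N.+1) seqDU F k.
  rewrite -bigsetU_seqDU; apply/seteqP; split=> // y _.
  have [i Ci] := Cc y; rewrite -bigcup_mkord; exists i => /=; first exact: ltn_ord.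
  by rewrite FE.
rewrite measure_bigsetU_ord.
- apply: eq_bigr => i _; rewrite -FE -[RHS]adde0 -(null i (ltn_ord i)).
  exact: measureDI.
- by move=> i; apply: measurableD.
- move=> i j _ _ ij; apply: val_inj; apply: (@trivIset_seqDU _ F) => //.
Qed.

Definition fan_cell x nu : set 'rV[R]_d := translate x (cone (facet a nu)).

Lemma fan_cellE x nu :
  fan_cell x nu = polyhedron (fun j => bary_form a nu - bary_form a j) (fun j => coord_diff a nu j x).
Proof.
rewrite /fan_cell translated_coneE //; apply/seteqP; split=> y /= H j.
  by rewrite -coord_diffE.
by rewrite coord_diffE; exact: H.
Qed.

Lemma closed_fan_cell x nu : closed (fan_cell x nu).
Proof. by rewrite fan_cellE; exact: closed_polyhedron. Qed.

Lemma measurable_fan_cell x nu : measurable (fan_cell x nu : set borel).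
Proof. by apply: closed_borel; exact: closed_fan_cell. Qed.

Lemma fan_measure_sum x : continuous_measure mu -> (\sum_nu mu (fan_cell x nu) = mu setT)%E.
Proof.
move=> mu_cont; apply: measure_almost_partition => [nu|nu j nj|y].
- exact: measurable_fan_cell.
- apply: (@null_subset _ _ mu _ (hyperplane (bary_form a nu - bary_form a j) (coord_diff a nu j x))).
  + by apply: measurableI; exact: measurable_fan_cell.
  + apply: closed_borel; rewrite (_ : hyperplane _ _ =
      (fun y => \sum_(i < d) (bary_form a nu - bary_form a j) ord0 i * y ord0 i) @^-1` [set coord_diff a nu j x]).
      apply: preimage_closed; last exact: closed_eq.
      by move=> y _; exact: continuous_linear_form.
    by apply/seteqP; split.
  + move=> y []; rewrite /fan_cell !translated_coneE //= => /(_ j) H1 /(_ nu) H2.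
    rewrite /hyperplane /= -coord_diffE; apply/eqP; rewrite eq_le H1 /=.
    by move: H2; rewrite /coord_diff; lra.
  + by apply: mu_cont; exact: coord_diff_neq0.
- pose nu := [arg min_(j < ord0) bary_coord a j (y - x)]%O.
  exists nu; rewrite /fan_cell translated_coneE //= => j.
  have : bary_coord a nu (y - x) <= bary_coord a j (y - x) by rewrite /nu; case: arg_minP => // i _; apply.
  by rewrite !bary_coordD -scaleN1r !bary_coordZ /coord_diff; lra.
Qed.

End FanMeasure.

Section CubeToSimplex.
Context {R : realType}.
Implicit Types x : nat -> R.

(** The running minimum of the coordinates, so that consecutive differences of the
    cuts are nonnegative on the cube and have sum 1. *)
Fixpoint cut x m : R := if m is m'.+1 then Num.min (cut x m') (x m') else 1.

(** A map from the cube to the simplex of barycentric coordinates that sends each facet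
    of the cube into a facet of the simplex. *)
Definition cube_bary d x nu : R := cut x nu - (if nu == d then 0 else cut x nu.+1).

Lemma cut_le1 x m : cut x m <= 1.
Proof. by elim: m => //= m IH; rewrite ge_min IH. Qed.

Lemma cut_ge0 x m : (forall j, 0 <= x j) -> 0 <= cut x m.
Proof. by move=> x0; elim: m => //= m IH; rewrite le_min IH x0. Qed.

Lemma cut_lip x x' h m : 0 <= h -> (forall j, `|x j - x' j| <= h) -> `|cut x m - cut x' m| <= h.
Proof.
move=> h0 xx'; elim: m => [|m IH] /=; first by rewrite subrr normr0.
move: IH (xx' m); rewrite !ler_norml => /andP[H1 H2] /andP[H3 H4]; rewrite /Num.min.
by case: ltP => H5; case: ltP => H6; apply/andP; split; lra.
Qed.

Lemma cube_bary_lip d x x' h nu : 0 <= h -> (forall j, `|x j - x' j| <= h) ->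
  `|cube_bary d x nu - cube_bary d x' nu| <= 2 * h.
Proof.
move=> h0 xx'; have := cut_lip nu h0 xx'; have := cut_lip nu.+1 h0 xx'.
by rewrite /cube_bary; case: eqP => _; rewrite !ler_norml; lra.
Qed.

Lemma cube_bary_sum d x : \sum_(nu < d.+1) cube_bary d x nu = 1.
Proof.
rewrite big_ord_recr /= /cube_bary eqxx subr0.
rewrite (eq_bigr (fun i : 'I_d => - cut x i.+1 - - cut x i)) => [|i _]; last first.
  by rewrite ltn_eqF // opprK addrC.
rewrite -(big_mkord xpredT (fun i => - cut x i.+1 - - cut x i)) telescope_sumr //.
by rewrite opprK addrAC addNr add0r.
Qed.

Lemma cube_bary_face d x m nu : (m < d)%N -> (forall j, 0 <= x j) ->
  (x m = 1 /\ nu = m) \/ (x m = 0 /\ nu = m.+1) -> cube_bary d x nu = 0.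
Proof.
move=> md x0 [[xm ->]|[xm ->]]; rewrite /cube_bary.
  rewrite ltn_eqF //= xm; suff -> : Num.min (cut x m) 1 = cut x m by rewrite subrr.
  by apply/min_idPl; exact: cut_le1.
have c0 : Num.min (cut x m) 0 = 0 by apply/min_idPr; exact: cut_ge0.
rewrite /= xm c0; case: ifP => _; rewrite ?subrr //.
by rewrite (_ : Num.min 0 _ = 0) ?subrr //; apply/min_idPl.
Qed.

End CubeToSimplex.

Section Fan.
Context {R : realType} {d' n : nat}.
Local Notation d := d'.+1.
Context (a : 'I_d.+1 -> 'rV[R]_d).
Hypothesis a_indep : affinely_independent a.
Hypothesis a_bary : barycenter a = 0.
Context (mu : 'I_n -> {finite_measure set (borelRd R d) -> \bar R}).
Hypothesis mu_supp : forall i, bounded_set (measure_support (mu i)).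

Definition apex (rad : R) (v : 'rV[R]_d) : 'rV[R]_d :=
  rad *: \sum_(nu < d.+1) cube_bary d (fun m => v ord0 (inord m)) nu *: a nu.

Lemma bary_coord_apex rad v nu :
  bary_coord a nu (apex rad v)
    = rad * (cube_bary d (fun m => v ord0 (inord m)) nu - d.+1%:R^-1).
Proof.
set t := cube_bary _ _; apply: (@bary_coord_unique _ _ _ a_indep (fun nu : 'I_d.+1 => rad * (t nu - d.+1%:R^-1))).
  rewrite -big_distrr sumrB /= cube_bary_sum sumr_const card_ord -[_ *+ d.+1]mulr_natl divff ?pnatr_eq0 //.
  by rewrite subrr mulr0.
under eq_bigr do rewrite -scalerA scalerBl.
by rewrite -scaler_sumr sumrB -scaler_sumr (vertex_sum0 a_bary) scaler0 subr0.
Qed.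

Lemma support_radius : exists2 M : R, 0 <= M &
  forall i y nu, measure_support (mu i) y -> `|bary_coord a nu y| <= M.
Proof.
have HK : \forall K \near +oo%R, forall i y, measure_support (mu i) y -> `|y| <= K.
  apply: (@filter_forall _ _ (fun i K => forall y, measure_support (mu i) y -> `|y| <= K) (pinfty_nbhs R)).
  move=> i; have [K0 [K0r HK0]] := mu_supp i; by exists K0; split.
have [K [K0 KS]] : exists K : R, 0 <= K /\ forall i y, measure_support (mu i) y -> `|y| <= K.
  have : \forall K \near +oo%R, 0 <= K /\ forall i y, measure_support (mu i) y -> `|y| <= K.
    by apply: filterI HK; exact: nbhs_pinfty_ge.
  exact: filter_ex.
pose W := \sum_(nu < d.+1) \sum_(i < d) `|bary_form a nu ord0 i|.
exists (W * K); first by rewrite mulr_ge0 // sumr_ge0 // => nu _; rewrite sumr_ge0.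
move=> i y nu Sy; rewrite bary_coordE.
apply: (le_trans (ler_norm_sum _ _ _)); apply: (@le_trans _ _ ((\sum_(i < d) `|bary_form a nu ord0 i|) * K)).
  rewrite big_distrl; apply: ler_sum => j _ /=; rewrite normrM ler_wpM2l //.
  apply: le_trans (KS i y Sy); have /mapP[l Hl ->] : `|y ord0 j| \in [seq `|y x.1 x.2| | x : 'I_1 * 'I_d].
    by apply/mapP; exists (ord0, j) => //=; rewrite mem_enum.
  by rewrite [leRHS]/Num.norm /= mx_normrE; apply/bigmax_geP; right => /=; exists l.
rewrite ler_wpM2r // /W (bigD1 nu) //= lerDl sumr_ge0 // => nu' _; exact: sumr_ge0.
Qed.

(** In the cell of nu, (d+1) beta_nu(y) = sum_j (beta_nu - beta_j)(y) is bounded by its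
    value at the apex, which is -rad when t_nu = 0. *)
Lemma exists_radius : exists2 rad : R, 0 < rad & forall (v : 'rV[R]_d) i (m : 'I_d) (nu : 'I_d.+1),
  (forall j, 0 <= v ord0 j) ->
  (v ord0 m = 1 /\ nu = m :> nat) \/ (v ord0 m = 0 /\ nu = m.+1 :> nat) ->
  mu i (fan_cell a (apex rad v) nu) = 0%E.
Proof.
have [M M0 MS] := support_radius; pose rad := (d.+1%:R * (M + 1)).
have rad0 : 0 < rad by rewrite mulr_gt0 ?ltr0n // ltr_wpDl.
exists rad => // v i m nu v0 face; apply: measure_off_support; first exact: closed_fan_cell.
apply/seteqP; split=> // y [].
rewrite /fan_cell translated_coneE // => Hy /(MS i y nu); rewrite ler_norml => /andP[+ _].
have bX : bary_coord a nu (apex rad v) = - (M + 1).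
  rewrite bary_coord_apex (@cube_bary_face _ d _ m nu) //; last by rewrite inord_val.
  by rewrite sub0r mulrN /rad mulrAC divff ?mul1r // pnatr_eq0.
have S0 z : \sum_j coord_diff a nu j z = d.+1%:R * bary_coord a nu z.
  rewrite sumrB sumr_const card_ord mulr_natl; have [-> _] := bary_coordP a_indep z.
  by rewrite subr0.
have : \sum_j coord_diff a nu j y <= \sum_j coord_diff a nu j (apex rad v).
  by apply: ler_sum => j _; exact: Hy.
by rewrite !S0 ler_pM2l ?ltr0n // bX; lra.
Qed.

Lemma coord_diff_apex rad v nu j :
  coord_diff a nu j (apex rad v) = rad * (cube_bary d (fun m => v ord0 (inord m)) nu
                                       - cube_bary d (fun m => v ord0 (inord m)) j).
Proof. by rewrite /coord_diff !bary_coord_apex -mulrBr opprB addrA subrK. Qed.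

(** The right-hand sides of the inequalities that define the cell are Lipschitz in v. *)
Lemma fan_cell_usc rad (v : 'rV[R]_d) i nu e : 0 < rad -> 0 < e ->
  \forall v' \near v, fine (mu i (fan_cell a (apex rad v') nu))
      < fine (mu i (fan_cell a (apex rad v) nu)) + e.
Proof.
move=> rad0 e0; have [h h0 Hh] := polyhedron_usc (mu i) (fun j => bary_form a nu - bary_form a j)
  (fun j => coord_diff a nu j (apex rad v)) e0.
have del0 : 0 < h / (4 * rad) by rewrite divr_gt0 // mulr_gt0.
apply/nbhs_ballP; exists (h / (4 * rad)) => //= v' [_ vv'].
rewrite !fan_cellE //; apply: Hh => j; rewrite !coord_diff_apex.
have lip l := @cube_bary_lip _ d (fun m => v ord0 (inord m)) (fun m => v' ord0 (inord m)) _ l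
  (ltW del0) (fun m => ltW (vv' ord0 (inord m))).
have := lip nu; have := lip j.
move: (cube_bary _ _ _) (cube_bary _ _ _) (cube_bary _ _ _) (cube_bary _ _ _) => A B C D.
rewrite !ler_norml => H1 H2.
have E : h = rad * (4 * (h / (4 * rad))) by field; rewrite gt_eqF.
move: H1 H2 del0 E; move: (h / (4 * rad)) => del H1 H2 del0 ->.
by rewrite -mulrDr ler_pM2l //; lra.
Qed.

End Fan.

Theorem theorem21 (R : realType) (n p k q d : nat)
  (n_gt0 : (0 < n)%N) (p_prime : prime p) (k_gt0 : (0 < k)%N)
  (qE : q = (p ^ k)%N) (dE : d = (n * (q - 1))%N)
  (a : 'I_d.+1 -> 'rV[R]_d)
  (a_indep : affinely_independent a)
  (a_bary : barycenter a = 0)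
  (mu : 'I_n -> {finite_measure set (borelRd R d) -> \bar R})
  (mu_cont : forall i, continuous_measure (mu i))
  (mu_supp : forall i, bounded_set (measure_support (mu i))) :
  exists (x : 'rV[R]_d) (theta : 'I_d.+1 -> 'I_q),
    forall (i : 'I_n) (j : 'I_q),
      (\sum_(nu < d.+1 | theta nu == j) mu i (translate x (cone (facet a nu)))
       = (q%:R^-1)%:E * mu i setT)%E.
Proof.
have q_gt1 : (1 < q)%N by rewrite qE -(expn0 p) ltn_exp2l ?prime_gt1.
have [F charF cardF] := pPrimePowerField p_prime k_gt0.
have [A [alpha [cardA alpha0 alphaP]]] := scalar_representatives p_prime charF.
case: d dE a a_indep a_bary mu mu_cont mu_supp => [|d'] dE a a_indep a_bary mu mu_cont mu_supp.
  by move: dE; rewrite subn1 => /esym/eqP; rewrite muln_eq0; lia.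
case: p p_prime k_gt0 qE charF cardF cardA alphaP => [//|p1] p_prime k_gt0 qE charF cardF cardA alphaP.
have dE' : (n * A * p1)%N = d'.+1 by rewrite -mulnA [(A * p1)%N]cardA cardF -qE dE subn1.
have [rad rad0 face] := exists_radius a_indep a_bary mu_supp.
pose G (v : 'rV[R]_d'.+1) i nu := fine (mu i (fan_cell a (apex a rad v) nu)).
have fineG v i nu : (G v i nu)%:E = mu i (fan_cell a (apex a rad v) nu).
  by rewrite fineK // fin_num_measure //; exact: measurable_fan_cell.
pose S i := fine (mu i setT).
have fineS i : (S i)%:E = mu i setT by rewrite fineK // fin_num_measure.
have G_sum v i : \sum_nu G v i nu = S i.
  apply: EFin_inj; rewrite -sumEFin fineS -(fan_measure_sum a_indep a_bary _ (apex a rad v)) //.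
  by apply: eq_bigr => nu _; exact: fineG.
have G_face (v : 'rV[R]_d'.+1) i (m : 'I_d'.+1) (nu : 'I_d'.+2) : (forall j, 0 <= v ord0 j) ->
  (v ord0 m = 1 /\ nu = m :> nat) \/ (v ord0 m = 0 /\ nu = m.+1 :> nat) -> G v i nu = 0.
  by move=> v0 H; rewrite /G (face v i m nu).
have G_usc (v : 'rV[R]_d'.+1) i nu e : 0 < e -> \forall v' \near v, G v' i nu < G v i nu + e.
  by move=> e0; exact: fan_cell_usc.
have [v [th Hth]] := exists_equipartition p_prime charF k_gt0 cardF alpha0 alphaP dE' G_face G_sum G_usc.
have cardFq : #|F| = q by rewrite cardF qE.
exists (apex a rad v), (fun nu => cast_ord cardFq (enum_rank (th nu))) => i j.
rewrite -fineS -EFinM mulrC.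
have := Hth i (enum_val (cast_ord (esym cardFq) j)); rewrite [in X in _ / X]cardFq.
move=> <-; rewrite -sumEFin; apply: eq_big => [nu|nu _]; last by rewrite fineG.
apply/eqP/eqP => [<-|->]; first by rewrite cast_ordK enum_rankK.
by rewrite enum_valK cast_ordKV.
Qed.
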